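(* Let $G$ be a graph with more than one edge, let $f:G\to G$ be a vertex map with linearization $L_f$, and suppose that the Markov matrix $M(L_f)$ is primitive. Let $h=h(L_f)$ denote the entropy of $L_f$. Then for any real $s$ with $0<s<h$ and any edge $E$ of $G$ there exist positive integers $k$ and $n$ such that $\frac{1}{k}\log n>s$ and $E$ has an $n$-horseshoe under $f^k$.
   Context: Graph: a connected space $G$ that is a union of finitely many vertices and finitely many edges $E_1,\dots,E_e$. Each edge is homeomorphic to $[0,1]$, its two boundary points are distinct vertices (no loops), no vertex is an interior point of an edge, and two distinct edges intersect in the empty set, one vertex or two vertices (so several edges may join the same two vertices). Each edge is given unit length via a fixed homeomorphism with $[0,1]$; a path of $m$ edges has length $m$. Vertex map: a continuous map $f:G\to G$ that permutes the vertices of $G$. Linearization: $L_f:G\to G$ agrees with $f$ on vertices, and for each edge $E_i$ with endpoints $V_1,V_2$, $L_f$ maps $E_i$ linearly (i.e. at constant speed with respect to edge length) onto the unique reduced (no backtracking) edge path from $f(V_1)$ to $f(V_2)$ that is homotopic to $f|_{E_i}$ relative to the endpoints of $E_i$. Markov matrix: $M=M(L_f)$ is the $e\times e$ matrix whose entry $M_{i,j}$ is the number of closed subintervals of $E_j$ that $L_f$ maps homeomorphically onto $E_i$ (equivalently, the number of times the edge path $L_f(E_j)$ traverses $E_i$). A non-negative square matrix $M$ is primitive if there is a positive integer $N$ such that for every $k\ge N$ every entry of $M^k$ is positive. Entropy: the topological entropy $h(L_f)$ is defined to be $\log\lambda$, where $\lambda$ is the spectral radius of $M(L_f)$. Horseshoe: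 for a vertex map $g:G\to G$ and positive integers $k,n$, an edge $E$ has an $n$-horseshoe under $g^k$ if there exist closed subintervals $J_1,\dots,J_n$ of $E$, each non-degenerate (with non-empty interior), with pairwise disjoint interiors, such that $J_1\cup\dots\cup J_n\subseteq g^k(J_1)\cap\dots\cap g^k(J_n)$. *)

(* Defs.v *)
(* MathComp-Analysis *)
From HB Require Import structures.
From mathcomp Require Import all_boot all_order all_algebra.
From mathcomp Require Import finmap complex.
From mathcomp Require Import all_classical all_reals all_analysis.

Set Implicit Arguments.
Unset Strict Implicit.
Unset Printing Implicit Defensive.

Import Order.TTheory GRing.Theory Num.Theory.
Import numFieldNormedType.Exports.

Local Open Scope classical_set_scope.
Local Open Scope ring_scope.

Definition maps_homeomorphically {T U : topologicalType} (f : T -> U)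
    (A : set T) (B : set U) : Prop :=
  [/\ {within A, continuous f}, set_bij A B f &
      exists2 g : U -> T, {within B, continuous g} &
        forall x, A x -> g (f x) = x].

(* The edges are indexed by 'I_nb_edges; [param i], of which only the
   restriction to [0, 1] matters, is the fixed homeomorphism that gives the
   i-th edge unit length. The Hausdorff condition excludes spaces such as a
   segment with a doubled point; with it, the edges are closed and the topology
   is the usual one obtained by gluing segments at their endpoints. *)
Record graph (R : realType) := Graph {
  carrier :> topologicalType;
  vertices : set carrier;
  nb_edges : nat;
  param : 'I_nb_edges -> R -> carrier;
  graph_hausdorff : hausdorff_space carrier;
  graph_connected : connected [set: carrier];
  finite_vertices : finite_set vertices;
  graph_cover :
    [set: carrier] = vertices `|` \bigcup_i (param i @` `[0, 1]);
  param_homeo : forall i,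
    maps_homeomorphically (param i) `[0, 1] (param i @` `[0, 1]);
  (* the two endpoints differ since [param i] is injective on [0, 1] *)
  param0_vertex : forall i, vertices (param i 0);
  param1_vertex : forall i, vertices (param i 1);
  param_inside : forall i t, 0 < t < 1 -> ~ vertices (param i t);
  (* as an edge contains exactly two vertices, two distinct edges share zero,
     one or two vertices and nothing else *)
  edge_meet : forall i j, i != j ->
    (param i @` `[0, 1]) `&` (param j @` `[0, 1]) `<=` vertices }.

Section GraphMaps.
Context {R : realType} {G : graph R}.
Implicit Types (i j : 'I_(nb_edges G)) (f g L : G -> G) (J : set G).

Definition edge i : set G := param i @` `[0, 1].

Definition vertex_map f : Prop :=
  continuous f /\ set_bij (vertices (g:=G)) (vertices (g:=G)) f.

(* [(i, false)] is the i-th edge run from [param i 0] to [param i 1], and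
   [(i, true)] is the same edge run backwards. *)
Definition oriented_edge : Type := ('I_(nb_edges G) * bool)%type.

Definition traverse (d : oriented_edge) (t : R) : G :=
  param d.1 (if d.2 then 1 - t else t).

Fixpoint edge_path (v : G) (p : seq oriented_edge) (w : G) : Prop :=
  if p is d :: p' then v = traverse d 0 /\ edge_path (traverse d 1) p' w
  else v = w.

Definition reduced (p : seq oriented_edge) : bool :=
  sorted (fun d d' => ~~ ((d.1 == d'.1) && (d.2 != d'.2))) p.

(* [c], restricted to [0, 1], runs at constant speed along the unit-length
   edges of [p]; nothing is required of [c] when [p] is empty. *)
Definition linear_along (p : seq oriented_edge) (c : R -> G) : Prop :=
  forall (k : 'I_(size p)) (t : R), 0 <= t <= 1 ->
    c ((k%:R + t) / (size p)%:R) = traverse (tnth (in_tuple p) k) t.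

Definition homotopic_rel_ends (c d : R -> G) : Prop :=
  exists H : R * R -> G,
    [/\ {within `[0, 1] `*` `[0, 1], continuous H},
        forall t, 0 <= t <= 1 -> H (0, t) = c t /\ H (1, t) = d t &
        forall s, 0 <= s <= 1 -> H (s, 0) = c 0 /\ H (s, 1) = c 1].

(* [L] is the linearization of [f]. The edge path [p] below is automatically
   nonempty when [f] is a vertex map, as then [f (param i 0) <> f (param i 1)];
   it is the unique reduced edge path in its homotopy class, so that [L] is
   determined by [f]. *)
Definition linearization f L : Prop :=
  (forall v, vertices v -> L v = f v) /\
  forall i, exists p : seq oriented_edge,
    [/\ edge_path (f (param i 0)) p (f (param i 1)), reduced p,
        linear_along p (L \o param i) &
        homotopic_rel_ends (f \o param i) (L \o param i)].

Definition closed_subinterval j J : Prop :=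
  exists a b : R, [/\ 0 <= a, a < b, b <= 1 & J = param j @` `[a, b]].

(* Leaving out the one-point subintervals is harmless, since they are not
   homeomorphic to an edge. [fset_set] is [fset0] on an infinite set, but for a
   linearization the counted set is finite. *)
Definition markov_matrix L : 'M[nat]_(nb_edges G) :=
  \matrix_(i, j) #|` fset_set
    [set J | closed_subinterval j J /\ maps_homeomorphically L J (edge i)] |.

(* Non-degeneracy and interiors of subintervals of the edge are read off in its
   coordinate: the interior of [param i @` `[a, b]] is the image of ]a, b[. *)
Definition horseshoe i (n : nat) g : Prop :=
  exists a b : 'I_n -> R,
    let J k := param i @` `[a k, b k] in
    [/\ forall k, [/\ 0 <= a k, a k < b k & b k <= 1],
        trivIset [set: 'I_n] (fun k => [set` `]a k, b k[%R]) &
        \bigcup_k J k `<=` \bigcap_k (g @` J k)].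

End GraphMaps.

Definition primitive_mx n (M : 'M[nat]_n) : Prop :=
  exists2 N : nat, (0 < N)%N &
    forall k, (N <= k)%N -> forall i j, (0 < (M ^+ k) i j)%N.

Definition spectral_radius {R : realType} n (M : 'M[nat]_n) : R :=
  sup [set Normc.normc z | z in
    [set z : complex R | eigenvalue (map_mx (fun m => m%:R : complex R) M) z]].

Definition topological_entropy {R : realType} {G : graph R} (L : G -> G) : R :=
  ln (spectral_radius (markov_matrix L)).

(* Main.v *)
Require Import Defs.
From HB Require Import structures.
From mathcomp Require Import all_boot all_order all_algebra.
From mathcomp Require Import finmap complex.
From mathcomp Require Import all_classical all_reals all_analysis.
From mathcomp Require Import zify ring lra.
Import Order.TTheory GRing.Theory Num.Theory.
Import numFieldNormedType.Exports.
Local Open Scope classical_set_scope.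
Local Open Scope ring_scope.

(* If [L] sends the edge [j] along the reduced path [p], then [f] restricted to
   [j] is homotopic to it, so it lifts to a path in the universal cover with the
   same ends as the geodesic [p]. The universal cover is a tree: retracting it
   on the k-th edge of [p] turns the lift of [f] into a map from [0, 1] onto
   [0, 1] which is the coordinate of [f] along that edge wherever it is not 0
   or 1. Hence [f] crosses every edge of [p] on disjoint intervals of [j], and
   pulling back such intervals along [f] gives [(M ^+ k) i j] disjoint
   subintervals of [j] whose images under [iter k f] contain the edge [i]. By
   primitivity, one diagonal entry of the powers of [M] grows at the rate of
   the spectral radius.
   A vertex of the universal cover is represented by a reduced word in the
   oriented edges, last edge first, and paths are lifted along a subdivision
   each segment of which lies in the open star of a vertex. *)

Set Implicit Arguments.
Unset Strict Implicit.
Unset Printing Implicit Defensive.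

(** * Continuity and crossings on the real line *)

Lemma continuous_within_comp {U V W : topologicalType} (A : set U) (B : set V)
    (c : U -> V) (g : V -> W) :
  continuous c -> (forall x, A x -> B (c x)) -> {within B, continuous g} ->
  {within A, continuous (g \o c)}.
Proof.
move=> cc AB /subspace_continuousP cg; apply/subspace_continuousP => x Ax.
move=> P /(cg _ (AB _ Ax)); rewrite /nbhs /= /within /= => nP.
have h : nbhs x [set y | B (c y) -> P (g (c y))] := cc x _ nP.
change (nbhs x [set y | A y -> P (g (c y))]).
by apply: filterS h => y /= yP Ay; exact/yP/AB.
Qed.

Lemma continuous_comp_into {U V W : topologicalType} (B : set V)
    (c : U -> V) (g : V -> W) :
  continuous c -> (forall x, B (c x)) -> {within B, continuous g} ->
  continuous (g \o c).
Proof.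
move=> cc AB /subspace_continuousP cg x.
move=> P /(cg _ (AB x)); rewrite /nbhs /= /within /= => nP.
have h : nbhs x [set y | B (c y) -> P (g (c y))] := cc x _ nP.
change (nbhs x [set y | P (g (c y))]).
by apply: filterS h => y /= yP; exact/yP/AB.
Qed.

Lemma eq_within_continuous {T U : topologicalType} (A : set T) (f g : T -> U) :
  (forall x, A x -> f x = g x) -> {within A, continuous f} ->
  {within A, continuous g}.
Proof.
move=> fg; apply: subspace_eq_continuous => x /set_mem Ax; exact: fg.
Qed.

Lemma continuous_pairl {T U : topologicalType} (x : T) :
  continuous (fun y : U => (x, y)).
Proof.
by move=> y; exact: (@cvg_pair U T U (nbhs y) (nbhs x) (nbhs y) _ _ _ (fun=> x)
  id (cvg_cst _) cvg_id).
Qed.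

Lemma continuous_pairr {T U : topologicalType} (y : U) :
  continuous (fun x : T => (x, y)).
Proof.
by move=> x; exact: (@cvg_pair T T U (nbhs x) (nbhs x) (nbhs y) _ _ _ id
  (fun=> y) cvg_id (cvg_cst _)).
Qed.

Section RealLine.
Context {R : realType}.
Implicit Types (a b c d t : R) (h : R -> R).

Definition clamp t : R := Num.max 0 (Num.min 1 t).

Lemma clamp_continuous : continuous clamp.
Proof.
move=> t; apply: (@continuous_max R R (cst 0) (fun t => Num.min 1 t) t).
  exact: cst_continuous.
apply: (@continuous_min R R (cst 1) id t); first exact: cst_continuous.
exact: cvg_id.
Qed.

Lemma clamp01 t : 0 <= clamp t <= 1.
Proof. by rewrite /clamp le_max lexx /= ge_max ge_min lexx ler01. Qed.

Lemma clamp_id t : 0 <= t <= 1 -> clamp t = t.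
Proof. by case/andP=> t0 t1; rewrite /clamp min_r // max_r. Qed.

Lemma intermediate_value h a b s : continuous h -> a <= b ->
  h a <= s <= h b -> exists2 t, a <= t <= b & h t = s.
Proof.
move=> ch ab /andP[as_ sb].
have [||t] := @IVT R h a b s ab.
- exact: continuous_subspaceT.
- by rewrite ge_min as_ le_max sb orbT.
by rewrite in_itv /= => abt hts; exists t.
Qed.

(* Take the first time [h] reaches [d], then the last time before it at which
   [h] is at [c]. *)
Lemma crossing_interval h a b c d : continuous h -> a <= b -> h a <= c ->
  c < d -> d <= h b ->
  exists a' b', [/\ a <= a', a' < b', b' <= b, h a' = c /\ h b' = d &
    forall t, a' < t < b' -> c < h t < d].
Proof.
move=> ch ab hac cd dhb.
have cid A : {within A, continuous (id : R -> R)}.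
  by apply: continuous_subspaceT => x; exact: cvg_id.
have comp (x y : R) (D : set R) : closed D -> compact (`[x, y] `&` h @^-1` D).
  move=> cD; apply: (@subclosed_compact _ _ `[x, y]); last by apply: subIsetl.
    apply: closedI; first exact: itv_closed.
    by apply: preimage_closed => // z _; exact: ch.
  exact: segment_compact.
have := @compact_EVT_min R R id (`[a, b] `&` h @^-1` [set x | d <= x]) _
  (comp _ _ _ (closed_ge (y:=d))) (cid _).
case=> [|b' /set_mem[/= ab' dhb'] minb'].
  by exists b; split => //=; rewrite in_itv /= ab lexx.
move: ab'; rewrite in_itv /= => /andP[ab' b'b].
have hb' : h b' = d.
  have [|t /andP[at_ tb'] htd] := @intermediate_value h a b' d ch ab'.
    by rewrite dhb' (le_trans hac) // ltW.
  suff -> : b' = t by [].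
  apply/eqP; rewrite eq_le tb' andbT; apply: minb'; rewrite inE; split => /=.
    by rewrite in_itv /= at_ (le_trans tb').
  by rewrite htd.
have := @compact_EVT_max R R id (`[a, b'] `&` h @^-1` [set x | x <= c]) _
  (comp _ _ _ (closed_le (y:=c))) (cid _).
case=> [|a' /set_mem[/= aa' hca'] maxa'].
  by exists a; split => //=; rewrite in_itv /= ab' lexx.
move: aa'; rewrite in_itv /= => /andP[aa' a'b'].
have ha' : h a' = c.
  have [|t /andP[a't tb'] htc] := @intermediate_value h a' b' c ch a'b'.
    by rewrite hca' hb' ltW.
  suff -> : a' = t by [].
  apply/eqP; rewrite eq_le a't /=; apply: maxa'; rewrite inE; split => /=.
    by rewrite in_itv /= tb' (le_trans aa').
  by rewrite htc.
exists a', b'; split => //.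
  rewrite lt_neqAle a'b' andbT; apply: contraTneq cd => a'b'E.
  by rewrite -ha' -hb' a'b'E ltxx.
move=> t /andP[a't tb']; apply/andP; split.
  rewrite ltNge; apply/negP => htc.
  have : t <= a'.
    apply: maxa'; rewrite inE; split => //=.
    by rewrite in_itv /= (ltW tb') (le_trans aa') // ltW.
  by rewrite leNgt a't.
rewrite ltNge; apply/negP => dht.
have : b' <= t.
  apply: minb'; rewrite inE; split => //=.
  by rewrite in_itv /= (le_trans aa' (ltW a't)) (le_trans (ltW tb')).
by rewrite leNgt tb'.
Qed.

(** Every point of the closed interval is a limit of interior points: push [t] towards the midpoint
    [u] by half of the smaller of [e] and half the length of the interval. *)
Lemma closed_itvoo_sub (K : set R) a b : a < b -> closed K ->
  (forall t, a < t < b -> K t) -> forall t, a <= t <= b -> K t.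
Proof.
move=> ab cK oK t /andP[at_ tb]; apply: cK => A /nbhs_ballP[e /= e0 eA].
set u := (a + b) / 2.
have [ta|ta] := leP t u.
  exists (t + Num.min e (u - a) / 2); split.
    apply: oK; rewrite /u in ta *.
    have : Num.min e ((a+b)/2 - a) <= (a+b)/2 - a by rewrite ge_min lexx orbT.
    have : 0 < Num.min e ((a+b)/2 - a) by rewrite lt_min e0; lra.
    lra.
  apply: eA; rewrite /ball /= opprD addrA subrr sub0r normrN gtr0_norm.
    have : Num.min e (u - a) <= e by rewrite ge_min lexx.
    lra.
  have : 0 < Num.min e (u - a) by rewrite lt_min e0 /u; lra.
  lra.
exists (t - Num.min e (b - u) / 2); split.
  apply: oK; rewrite /u in ta *.
  have : Num.min e (b - (a+b)/2) <= b - (a+b)/2 by rewrite ge_min lexx orbT.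
  have : 0 < Num.min e (b - (a+b)/2) by rewrite lt_min e0; lra.
  lra.
apply: eA; rewrite /ball /= opprB addrC subrK gtr0_norm.
  have : Num.min e (b - u) <= e by rewrite ge_min lexx.
  lra.
have : 0 < Num.min e (b - u) by rewrite lt_min e0 /u; lra.
lra.
Qed.

End RealLine.

(** * Topology of a graph *)

Section GraphTopology.
Context {R : realType} {G : graph R}.
Implicit Types (i j : 'I_(nb_edges G)) (t u : R) (x y v w : G).

Local Notation V := (@vertices R G).

Lemma edge_closed i : closed (edge i).
Proof.
apply: compact_closed; first exact: graph_hausdorff.
apply: continuous_compact; last exact: segment_compact.
by have [] := param_homeo i.
Qed.

Lemma vertices_subset_closed (A : set G) : A `<=` V -> closed A.
Proof.
move=> AV; have := hausdorff_accessible (@graph_hausdorff R G).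
move/accessible_finite_set_closed; apply; apply: sub_finite_set AV _.
exact: finite_vertices.
Qed.

Lemma param_inj i t u : 0 <= t <= 1 -> 0 <= u <= 1 ->
  param i t = param i u -> t = u.
Proof.
by move=> t01 u01; have [_ [_ inj _] _] := param_homeo i; apply: inj;
  rewrite inE /= in_itv.
Qed.

Lemma param01 i : param i 0 <> param i 1.
Proof.
move/param_inj; rewrite !lexx !ler01 => /(_ isT isT)/eqP.
by rewrite eq_sym oner_eq0.
Qed.

Lemma mem_edge i t : 0 <= t <= 1 -> edge i (param i t).
Proof. by move=> t01; exists t; rewrite //= in_itv. Qed.

Lemma edge_vertex i x : edge i x -> V x -> x = param i 0 \/ x = param i 1.
Proof.
case=> t; rewrite /= in_itv /= => /andP[t0 t1] <- Vx.
have [->|tn0] := eqVneq t 0; first by left.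
have [->|tn1] := eqVneq t 1; first by right.
by case: (@param_inside R G i t _ Vx); rewrite !lt_neqAle t0 t1 eq_sym tn0 tn1.
Qed.

Lemma edge_uniq i j x : edge i x -> edge j x -> ~ V x -> i = j.
Proof.
move=> ix jx nV; apply/eqP; apply/negP => /negP ij.
by apply: nV; apply: (edge_meet ij).
Qed.

Lemma param_clamp_continuous i : continuous (param i \o clamp).
Proof.
have [ci _ _] := param_homeo i.
apply: continuous_comp_into ci; first exact: clamp_continuous.
by move=> t; rewrite /= in_itv; exact: clamp01.
Qed.

Definition open_edge i : set G := edge i `\` V.

Lemma open_edgeC i :
  ~` open_edge i = V `|` \bigcup_(j in [set j | j != i]) edge j.
Proof.
apply/seteqP; split=> x.
  move=> nix; have [Vx|nVx] := pselect (V x); [by left | right].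
  have : [set: G] x by [].
  rewrite graph_cover => -[//|[j _ jx]]; exists j => //=.
  by apply: contra_notN nix => /eqP <-.
case=> [Vx []//|[j /eqP ji jx] [ix nVx]].
by apply: ji; apply: edge_uniq nVx.
Qed.

Lemma closed_open_edgeC i : closed (~` open_edge i).
Proof.
rewrite open_edgeC; apply: closedU; first exact: vertices_subset_closed.
by apply: closed_bigcup => [|j _]; [exact: finite_finset|exact: edge_closed].
Qed.

(** Off the vertices, [open_edge i] is open, its complement being a finite union of closed sets, and
    closed, being the trace of [edge i]. A connected [K] without vertices therefore lies in it or
    misses it. *)
Lemma connected_open_edge i (K : set G) x y : connected K ->
  K `&` V `<=` set0 ->
  K x -> K y -> open_edge i x -> open_edge i y.
Proof.
move=> cK KV Kx Ky ix.
suff : K `&` open_edge i = K by move=> E; have : K y by []; rewrite -E => -[].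
apply: cK; first by exists x.
  exists (open_edge i) => //.
  by rewrite -closedC; exact: closed_open_edgeC.
exists (edge i); first exact: edge_closed.
by apply/seteqP; split => z [Kz iz]; split => //; [case: iz|
  split => // Vz; apply: (KV z)].
Qed.

(** The open star of [v]. It contains no other vertex, and a point shared by the stars of two
    distinct vertices is interior to an edge joining them, so that passing from one star to the
    other is recorded by a single oriented edge. *)
Definition star v : set G :=
  [set x | x = v \/ exists2 i, open_edge i x & v = param i 0 \/ v = param i 1].

Lemma star_cover x : exists2 v, V v & star v x.
Proof.
have [Vx|nVx] := pselect (V x); first by exists x => //; left.
have : [set: G] x by [].
rewrite graph_cover => -[//|[j _ jx]].
exists (param j 0); first exact: param0_vertex.
by right; exists j => //; left.
Qed.

Lemma star_vertex v x : star v x -> V x -> x = v.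
Proof. by case=> // -[i [_ nV]]. Qed.

Lemma star_open v : V v -> open (star v).
Proof.
move=> Vv.
suff -> : star v = ~` ((V `\ v) `|`
    \bigcup_(i in [set i | v <> param i 0 /\ v <> param i 1]) edge i).
  apply: closed_openC; apply: closedU.
    by apply: vertices_subset_closed => x [].
  by apply: closed_bigcup => [|j _]; [exact: finite_finset|exact: edge_closed].
apply/seteqP; split => x.
  case=> [->|[i [ix nVx] vi]].
    case=> [[_ /(_ erefl)]//|[i [v0 v1] iv]].
    by have [] := edge_vertex iv Vv.
  case=> [[]//|[j [v0 v1] jx]].
  by have ij := edge_uniq ix jx nVx; subst j; case: vi.
move=> /not_orP[xv xe]; have [Vx|nVx] := pselect (V x).
  by left; apply: contrapT => nxv; apply: xv.
right; have : [set: G] x by [].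
rewrite graph_cover => -[//|[j _ jx]]; exists j => //.
apply: contrapT => /not_orP[v0 v1]; apply: xe; exists j => //.
Qed.

End GraphTopology.

(** * Reduced words in the oriented edges *)

Section Words.
Context {R : realType} {G : graph R}.
Implicit Types (d e : @oriented_edge R G) (g p : seq (@oriented_edge R G)).

Definition inv_dart d : @oriented_edge R G := (d.1, ~~ d.2).

Lemma inv_dartK : involutive inv_dart.
Proof. by case=> i b; rewrite /inv_dart /= negbK. Qed.

(** Multiplication by [d] followed by free reduction. The head of [g] is the last edge travelled, so
    a reduced [g] can only cancel there. *)
Definition push d g :=
  if g is e :: g' then if e == inv_dart d then g' else d :: g else [:: d].

(** Change between the coordinate of the edge [d.1] and the coordinate along [d]; it is its own
    inverse. *)
Definition orient d (t : R) := if d.2 then 1 - t else t.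

Lemma orient01 d (t : R) : 0 <= t <= 1 -> 0 <= orient d t <= 1.
Proof. by rewrite /orient; case: d.2 => //; lra. Qed.

Lemma traverse_orient d (t : R) : traverse d (orient d t) = param d.1 t.
Proof.
by rewrite /traverse /orient; case: d.2; rewrite // opprB addrC subrK.
Qed.

Lemma edge_traverse d : edge d.1 = traverse d @` `[0, 1].
Proof.
apply/seteqP; split => [_ [t t01 <-]|_ [t t01 <-]]; rewrite /= in_itv /= in t01.
  exists (orient d t); last exact: traverse_orient.
  by rewrite /= in_itv /= orient01.
by apply: mem_edge; exact: (orient01 d).
Qed.

Lemma traverse_inv d (t : R) : traverse (inv_dart d) t = traverse d (1 - t).
Proof.
by case: d => i [] /=; rewrite /traverse //= opprB addrC subrK.
Qed.

Lemma reduced_cons d e g :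
  reduced (d :: e :: g) = (e != inv_dart d) && reduced (e :: g).
Proof.
rewrite /reduced /=; congr (_ && _); congr (~~ _).
case: d e => [i b] [j c]; rewrite /inv_dart /= xpair_eqE eq_sym; congr (_ && _).
by case: b; case: c.
Qed.

Lemma reduced_behead d g : reduced (d :: g) -> reduced g.
Proof. by case: g => // e g; rewrite reduced_cons => /andP[]. Qed.

Lemma reduced_push d g : reduced g -> reduced (push d g).
Proof.
case: g => // e g; rewrite /push; case: ifP => [_|ne rg].
  exact: reduced_behead.
by rewrite reduced_cons ne.
Qed.

Lemma push_inv d g : reduced g -> push (inv_dart d) (push d g) = g.
Proof.
case: g => [_|e g rg]; first by rewrite /= inv_dartK eqxx.
rewrite [push d _]/push; case: eqP => [E|_]; last by rewrite /= inv_dartK eqxx.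
move: rg; rewrite {}E; case: g => [|e' g]//.
by rewrite reduced_cons /= => /andP[/negPf -> _].
Qed.

Lemma reduced_rev p : reduced (rev p) = reduced p.
Proof.
rewrite /reduced rev_sorted; apply: eq_sorted => d e.
by rewrite eq_sym [d.2 == _]eq_sym.
Qed.

(** Having [D :: P] as a suffix tells on which side of the lifted edge from [P] to [D :: P] the
    vertex [g] of the tree lies. One step changes the side only by running through that edge, in one
    direction or the other: these are the two exceptions. *)
Lemma suffix_push D P d g : suffix (D :: P) (push d g) = suffix (D :: P) g
  \/ (g = P /\ d = D) \/ (g = D :: P /\ d = inv_dart D).
Proof.
have suf e h :
    suffix (D :: P) (e :: h) = (D :: P == e :: h) || suffix (D :: P) h.
  apply/idP/orP => [/suffixP[[|a s] /=]|[/eqP <-|sh]].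
  - by move=> ->; left.
  - by case=> _ ->; right; exact: suffix_suffix.
  - exact: suffix_refl.
  - exact: (@suffix_catr _ _ _ [:: e]).
case: g => [|e g] /=.
  rewrite suf; case: eqP => [[-> ->]|_]; last by left.
  by right; left.
case: eqP => [e_inv|_]; last first.
  by rewrite [in LHS]suf; case: eqP => [[-> ->]|_]; [right; left|left].
rewrite suf; case: eqP => [[-> ->]|_]; last by left.
by right; right; rewrite e_inv inv_dartK.
Qed.

End Words.

(** * Lifting paths to the universal cover *)

Section Lifting.
Context {R : realType} {G : graph R}.
Implicit Types (i j : 'I_(nb_edges G)) (t : R) (x y u v w : G).
Implicit Types (d e : @oriented_edge R G) (g p : seq (@oriented_edge R G)).

Local Notation V := (@vertices R G).

Lemma traverse_vertex d : V (traverse d 0) /\ V (traverse d 1).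
Proof.
by case: d => i []; rewrite /traverse /= ?subr0 ?subrr; split;
  (exact: param0_vertex || exact: param1_vertex).
Qed.

Lemma traverse01 d : traverse d 0 <> traverse d 1.
Proof.
case: d => i []; rewrite /traverse /= ?subr0 ?subrr; last exact: param01.
by move/esym; exact: param01.
Qed.

Lemma dart_uniq d e : d.1 = e.1 -> traverse d 0 = traverse e 0 -> d = e.
Proof.
case: d e => i b [j c] /= ->; rewrite /traverse /=.
by case: b; case: c; rewrite ?subr0 // => E; case: (@param01 R G j).
Qed.

Lemma star_traverse d x : open_edge d.1 x ->
  star (traverse d 0) x /\ star (traverse d 1) x.
Proof.
by case: d => i b /= ix; split; right; exists i => //; case: b;
  rewrite /traverse /= ?subr0 ?subrr; [right|left|left|right].
Qed.

(* The deck coordinate of a point [x] lifted to the universal cover: passing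
   from the star of [u] to the star of [v] through the edge containing [x]
   multiplies the word by that edge. *)
Definition act x u v g :=
  if u == v then g
  else if [pick i | `[< open_edge i x >]] is Some i
  then push (i, u == param i 1) g else g.

Lemma act_refl x u g : act x u u g = g.
Proof. by rewrite /act eqxx. Qed.

Lemma act_push d x g : open_edge d.1 x ->
  act x (traverse d 0) (traverse d 1) g = push d g.
Proof.
move=> ix; rewrite /act; case: eqP => [/traverse01//|_].
case: pickP => [j /asboolP jx|/(_ d.1)/asboolP//].
have <- : d.1 = j by case: ix jx => ix nV [jx _]; exact: edge_uniq nV.
congr (push _ _); clear ix; case: d => i b; congr (_, _); rewrite /traverse /=.
case: b; rewrite ?subr0 ?eqxx //.
by apply/eqP; exact: param01.
Qed.

Lemma act_dart x u v : V u -> V v -> star u x -> star v x -> u <> v ->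
  exists d, [/\ open_edge d.1 x, traverse d 0 = u & traverse d 1 = v].
Proof.
move=> Vu Vv ux vx uv; case: ux => [ux|[i ix iu]].
  case: vx => [vx|[i [_ nV] _]]; first by case: uv; rewrite -ux vx.
  by case: nV; rewrite ux.
case: vx => [vx|[j jx jv]]; first by case: ix => _ []; rewrite vx.
have ij : i = j by case: ix jx => ix nV [jx _]; exact: edge_uniq nV.
subst j; case: iu => iu; case: jv => iv; try by case: uv; rewrite iu iv.
  by exists (i, false); rewrite /traverse.
by exists (i, true); rewrite /traverse /= subr0 subrr.
Qed.

Lemma reduced_act x u v g : reduced g -> reduced (act x u v g).
Proof.
by rewrite /act; case: ifP => // _; case: pickP => // i _; exact: reduced_push.
Qed.

(** If [u], [v] differ and [v], [w] differ, then [x] is inside an edge, which has only two ends, so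
    [w = u] and the second push undoes the first. *)
Lemma act_comp x u v w g : V u -> V v -> V w -> star u x -> star v x ->
  star w x -> reduced g -> act x v w (act x u v g) = act x u w g.
Proof.
move=> Vu Vv Vw ux vx wx rg.
have [->|/eqP uv] := eqVneq u v; first by rewrite act_refl.
have [->|/eqP vw] := eqVneq v w; first by rewrite act_refl.
have [d [dx d0 d1]] := act_dart Vu Vv ux vx uv.
have [e [ex e0 e1]] := act_dart Vv Vw vx wx vw.
have E : d.1 = e.1 by case: dx ex => dx nV [ex _]; exact: edge_uniq nV.
have {E} E : inv_dart d = e.
  by apply: dart_uniq => //; rewrite traverse_inv subr0 d1 e0.
have -> : w = u by rewrite -e1 -E traverse_inv subrr.
rewrite act_refl -{1}d1 -{1}d0 -{1}d1 -{1}d0 act_push //.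
rewrite -[traverse d 0](congr1 (traverse d) (subrr 1)) -traverse_inv.
rewrite -[traverse d 1](congr1 (traverse d) (subr0 1)) -traverse_inv.
by rewrite act_push ?push_inv.
Qed.

(** A vertex in both stars would be the centre of each. So for [u <> v] the set [K] avoids the
    vertices and, being connected, stays in one open edge. *)
Lemma act_const (K : set G) x y u v g : connected K -> K `<=` star u ->
  K `<=` star v -> V u -> V v -> K x -> K y -> act x u v g = act y u v g.
Proof.
move=> cK Ku Kv Vu Vv Kx Ky.
have [->|/eqP uv] := eqVneq u v; first by rewrite !act_refl.
have [d [dx d0 d1]] := act_dart Vu Vv (Ku _ Kx) (Kv _ Kx) uv.
have dy : open_edge d.1 y.
  apply: connected_open_edge cK _ Kx Ky dx => z [Kz Vz]; apply: uv.
  by rewrite -(star_vertex (Ku _ Kz) Vz) -(star_vertex (Kv _ Kz) Vz).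
by rewrite -d0 -d1 !act_push.
Qed.

(** Read from its last letter to its head, [g] is an edge path from [v0] to [v]; a reduced such [g]
    is a vertex over [v] of the universal cover based at [v0]. *)
Fixpoint chain v0 g v : Prop :=
  if g is d :: g' then v = traverse d 1 /\ chain v0 g' (traverse d 0)
  else v = v0.

Lemma chain_uniq v0 g u v : chain v0 g u -> chain v0 g v -> u = v.
Proof. by case: g => [-> ->|d g [-> _] [-> _]]. Qed.

Lemma chain_push v0 d g : chain v0 g (traverse d 0) ->
  chain v0 (push d g) (traverse d 1).
Proof.
case: g => [|e g] /=; first by move=> ->.
case=> de ch; case: eqP => [E|_]; last by split.
by move: ch; rewrite E traverse_inv subr0.
Qed.

Lemma chain_act v0 x u v g : V u -> V v -> star u x -> star v x ->
  chain v0 g u -> chain v0 (act x u v g) v.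
Proof.
move=> Vu Vv ux vx.
have [->|/eqP uv] := eqVneq u v; first by rewrite act_refl.
have [d [dx <- <-]] := act_dart Vu Vv ux vx uv.
by rewrite act_push //; exact: chain_push.
Qed.

(** Here [v b] is the centre of a star containing the [b]-th segment of a subdivided path, and
    [x b.+1] is the point common to the segments [b] and [b.+1]. The value at [b] is the vertex of
    the universal cover whose star contains the lift of the [b]-th segment. *)
Fixpoint lift (v x : nat -> G) (b : nat) : seq (@oriented_edge R G) :=
  if b is b'.+1 then act (x b) (v b') (v b) (lift v x b') else [::].

Lemma reduced_lift (v x : nat -> G) b : reduced (lift v x b).
Proof. by elim: b => //= b; exact: reduced_act. Qed.

Lemma chain_lift (v x : nat -> G) b :
  (forall k, (k <= b)%N -> V (v k)) ->
  (forall k, (k < b)%N -> star (v k) (x k.+1) /\ star (v k.+1) (x k.+1)) ->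
  chain (v 0) (lift v x b) (v b).
Proof.
elim: b => //= b IH Vv st.
have [s1 s2] := st b (ltnSn b).
apply: chain_act => //; try exact: Vv.
by apply: IH => k kb; [apply: Vv; exact: leqW | apply: st; exact: leqW].
Qed.

Lemma lift_ext (v x y : nat -> G) b :
  (forall k g, (k < b)%N ->
     act (x k.+1) (v k) (v k.+1) g = act (y k.+1) (v k) (v k.+1) g) ->
  lift v x b = lift v y b.
Proof.
elim: b => //= b IH E; rewrite E // IH // => k g kb; apply: E; exact: leqW.
Qed.

Lemma connected_path_image (c : R -> G) (a b : R) : continuous c ->
  connected (c @` `[a, b]).
Proof.
move=> cc; apply: connected_continuous_connected.
  exact: segment_connected.
exact: continuous_subspaceT.
Qed.

(** Two labellings of one path by stars give lifts that differ by the change of star at the current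
    point. In the induction, [act_comp] exchanges the two changes of label at a subdivision point
    and [act_const] moves that point along the next segment. *)
Lemma lift_relabel (c : R -> G) (tau : nat -> R) (u v : nat -> G) (m : nat) :
  continuous c -> (forall b, tau b <= tau b.+1) ->
  (forall b, (b <= m)%N -> V (u b) /\ V (v b)) ->
  (forall b t, (b <= m)%N -> tau b <= t <= tau b.+1 ->
     star (u b) (c t) /\ star (v b) (c t)) ->
  u 0 = v 0 -> forall b t, (b <= m)%N -> tau b <= t <= tau b.+1 ->
  lift v (c \o tau) b = act (c t) (u b) (v b) (lift u (c \o tau) b).
Proof.
move=> cc tauS Vuv st uv0; elim=> [|b IH] t bm tb.
  by rewrite uv0 act_refl.
have bm' : (b <= m)%N by exact: ltnW.
have t1 : tau b <= tau b.+1 <= tau b.+1 by rewrite lexx tauS.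
have t2 : tau b.+1 <= tau b.+1 <= tau b.+2 by rewrite lexx tauS.
have [s1 s2] := st _ _ bm' t1.
have [s3 s4] := st _ _ bm t2.
have [V1 V2] := Vuv _ bm'; have [V3 V4] := Vuv _ bm.
rewrite /= (IH _ bm' t1) act_comp //; last exact: reduced_lift.
rewrite -(@act_const (c @` `[tau b.+1, tau b.+2]) (c (tau b.+1)) (c t)) //.
- by rewrite act_comp //; exact: reduced_lift.
- exact: connected_path_image.
- by move=> y [z] /=; rewrite in_itv /= => zb <-; have [] := st _ _ bm zb.
- by move=> y [z] /=; rewrite in_itv /= => zb <-; have [] := st _ _ bm zb.
Qed.

(** * Homotopy invariance of the end of a lift *)

Section Grid.
Variables (H : R * R -> G) (N : nat) (v : nat -> nat -> G) (x0 x1 : G).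
Hypotheses (H_continuous : continuous H) (N_gt0 : (0 < N)%N).
Hypothesis v_vertex : forall a b, V (v a b).
Let tau (b : nat) : R := b%:R / N%:R.
Hypothesis H_star : forall a b s t, (a < N)%N -> (b < N)%N ->
  tau a <= s <= tau a.+1 -> tau b <= t <= tau b.+1 -> star (v a b) (H (s, t)).
Hypotheses (Vx0 : V x0) (Vx1 : V x1).
Hypothesis H_sides : forall s, 0 <= s <= 1 -> H (s, 0) = x0 /\ H (s, 1) = x1.

Let tauS b : tau b <= tau b.+1.
Proof. by rewrite ler_pM2r ?invr_gt0 ?ltr0n // ler_nat. Qed.

Let tau01 b : (b <= N)%N -> 0 <= tau b <= 1.
Proof.
move=> bN; rewrite divr_ge0 ?ler0n // ler_pdivrMr ?ltr0n // mul1r.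
by rewrite ler_nat.
Qed.

Let tau0 : tau 0 = 0. Proof. by rewrite /tau mul0r. Qed.
Let tauN : tau N = 1. Proof. by rewrite /tau divff // pnatr_eq0 -lt0n. Qed.

Let row (s : R) (b : nat) : G := H (s, tau b).

Let Ht_continuous t : continuous (fun s => H (s, t)).
Proof.
move=> s; apply: (@continuous_comp _ _ _ (fun s => (s, t)) H).
  exact: continuous_pairr.
exact: H_continuous.
Qed.

Let Hs_continuous s : continuous (fun t => H (s, t)).
Proof.
move=> t; apply: (@continuous_comp _ _ _ (fun t => (s, t)) H).
  exact: continuous_pairl.
exact: H_continuous.
Qed.

Let lift_vertical a : (a < N)%N ->
  lift (v a) (row (tau a)) N.-1 = lift (v a) (row (tau a.+1)) N.-1.
Proof.
move=> aN; apply: lift_ext => b g bN.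
have bN' : (b.+1 < N)%N by lia.
have bN'' : (b < N)%N by lia.
apply: (@act_const ((fun s => H (s, tau b.+1)) @` `[tau a, tau a.+1])) => //.
- exact: connected_path_image.
- move=> y [s] /=; rewrite in_itv /= => sa <-; apply: H_star => //.
  by rewrite lexx tauS.
- move=> y [s] /=; rewrite in_itv /= => sa <-; apply: H_star => //.
  by rewrite lexx tauS.
- by exists (tau a) => //=; rewrite in_itv /= lexx tauS.
- by exists (tau a.+1) => //=; rewrite in_itv /= lexx tauS.
Qed.

Let label_left a : (a < N)%N -> v a 0 = x0.
Proof.
move=> aN; have : star (v a 0) (H (tau a, 0)).
  apply: H_star => //; first by rewrite lexx tauS.
  by have := tauS 0; rewrite tau0 lexx.
have [-> _] := H_sides (tau01 (ltnW aN)).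
by move/star_vertex => /(_ Vx0).
Qed.

Let label_right a : (a < N)%N -> v a N.-1 = x1.
Proof.
move=> aN; have : star (v a N.-1) (H (tau a, 1)).
  apply: H_star; rewrite ?prednK ?tauN ?lexx ?tauS ?andbT //.
  by have := tauS N.-1; rewrite prednK // tauN.
have [_ ->] := H_sides (tau01 (ltnW aN)).
by move/star_vertex => /(_ Vx1).
Qed.

Let lift_row a : (a.+1 < N)%N ->
  lift (v a) (row (tau a.+1)) N.-1 = lift (v a.+1) (row (tau a.+1)) N.-1.
Proof.
move=> aN; have aN' : (a < N)%N by exact: ltnW.
rewrite [RHS](@lift_relabel (fun t => H (tau a.+1, t)) tau (v a) (v a.+1) N.-1
  _ _ _ _ _ N.-1 (tau N.-1)) //.
- by rewrite !label_right // act_refl.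
- move=> b t bN tb; have {}bN : (b < N)%N by lia.
  by split; apply: H_star => //; rewrite lexx tauS.
- by rewrite !label_left.
- by rewrite lexx tauS.
Qed.

(** Each row of squares is passed in two moves: [lift_vertical] slides the subdivision points up
    inside their stars, and [lift_row] replaces the labels of the row by those of the next. As the
    ends are fixed vertices, all rows have first label [x0] and last label [x1], so relabelling does
    not change the final word. *)
Lemma lift_homotopic : lift (v 0) (fun b => H (0, b%:R / N%:R)) N.-1 =
  lift (v N.-1) (fun b => H (1, b%:R / N%:R)) N.-1.
Proof.
have rows a : (a < N)%N ->
    lift (v 0) (row (tau 0)) N.-1 = lift (v a) (row (tau a.+1)) N.-1.
  elim: a => [|a IH] aN; first by rewrite lift_vertical.
  by rewrite IH ?(ltnW aN) // lift_row // lift_vertical.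
have := rows N.-1; rewrite (ltn_predL N) N_gt0 prednK // tau0 tauN.
exact.
Qed.

End Grid.

Lemma grid_labels (H : R * R -> G) : continuous H ->
  exists N0 : nat, forall N : nat, (N0 <= N)%N -> (0 < N)%N ->
  exists v : nat -> nat -> G, (forall a b, V (v a b)) /\
  forall a b s t, (a < N)%N -> (b < N)%N ->
    a%:R / N%:R <= s <= a.+1%:R / N%:R -> b%:R / N%:R <= t <= b.+1%:R / N%:R ->
    star (v a b) (H (s, t)).
Proof.
move=> cH.
have sq : compact (`[0, 1] `*` `[0, 1] : set (R * R)).
  by apply: compact_setX; exact: segment_compact.
(* A Lebesgue number argument: the predicate says that the square of side [1 / N.+1] with lower left
   corner [z] is mapped into one star. Near [z], half of the radius [e] pays for moving the corner
   and half for the side of the square. *)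
have := iffLR (compact_near_coveringP _) sq nat \oo
  (fun N z => exists2 v, V v & forall s t,
      z.1 <= s <= z.1 + N.+1%:R^-1 -> z.2 <= t <= z.2 + N.+1%:R^-1 ->
      star v (H (s, t))) _.
case=> [z _|N0 _ HN0].
  have [v Vv vz] := star_cover (H z).
  have : nbhs z (H @^-1` star v).
    by apply: cH; apply: open_nbhs_nbhs; split => //; exact: star_open.
  rewrite -nbhs_ballE => -[e /= e0 eH].
  have e20 : 0 < e / 2 by lra.
  have NN : \forall n \near \oo, (n.+1%:R^-1 : R) < e / 2.
    have := near_infty_natSinv_lt (PosNum e20).
    by [].
  near=> z' N => /=; exists v => // s t s1 t1; apply: eH.
  have zz' : ball z (e / 2) z' by near: z'; exact: nbhsx_ballx.
  have Ne : N.+1%:R^-1 < e / 2 by near: N.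
  case: zz'; rewrite /ball /= !ltr_norml => b1 b2.
  move: b1 b2 s1 t1 Ne; rewrite /=; move: (N.+1%:R^-1) => q b1 b2 s1 t1 Ne.
  by split; rewrite /ball /= ltr_norml; lra.
exists N0.+1 => N NN N0'.
have key (ab : nat * nat) : exists v, V v /\ ((ab.1 < N)%N -> (ab.2 < N)%N ->
    forall s t, ab.1%:R / N%:R <= s <= ab.1.+1%:R / N%:R ->
      ab.2%:R / N%:R <= t <= ab.2.+1%:R / N%:R -> star v (H (s, t))).
  have [/andP[aN bN]|nab] := boolP ((ab.1 < N)%N && (ab.2 < N)%N); last first.
    have [v Vv _] := star_cover (H (0, 0)); exists v; split => // aN bN.
    by move: nab; rewrite aN bN.
  have [||v Vv vst] := HN0 N.-1 _ (ab.1%:R / N%:R, ab.2%:R / N%:R).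
  - by rewrite /=; lia.
  - have Np : 0 < N%:R :> R by rewrite ltr0n.
    by split; rewrite /= in_itv /= divr_ge0 ?ler0n //= ler_pdivrMr // mul1r
      ler_nat ltnW.
  - exists v; split => // _ _ s t s1 t1; move: vst; rewrite /= prednK // => vst.
    by apply: vst; rewrite -?natr1 ?mulrDl ?mul1r in s1 t1 *.
have [v vP] := choice key.
exists (fun a b => v (a, b)); split => [a b|a b s t aN bN s1 t1].
  by have [] := vP (a, b).
by have [_ /(_ aN bN s t s1 t1)] := vP (a, b).
Unshelve. all: by end_near.
Qed.

End Lifting.

(** * Lifts of edge paths *)

Section LinearPath.
Context {R : realType} {G : graph R}.
Implicit Types (i j : 'I_(nb_edges G)) (t : R) (x y u v w : G).
Implicit Types (d e : @oriented_edge R G) (g : seq (@oriented_edge R G)).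

Local Notation V := (@vertices R G).

Lemma open_edge_traverse d t : 0 < t < 1 -> open_edge d.1 (traverse d t).
Proof.
case: d => i b t01; rewrite /traverse /=.
have t01' : 0 < (if b then 1 - t else t) < 1 by case: b; lra.
split; last exact: param_inside.
by apply: mem_edge; case/andP: t01' => /ltW -> /ltW ->.
Qed.

Lemma star_same i v x y : V v -> open_edge i x -> open_edge i y ->
  star v x -> star v y.
Proof.
move=> Vv [ix nV] iy [xv|[j [jx _] jv]]; first by case: nV; rewrite xv.
by right; exists i => //; rewrite (edge_uniq ix jx nV).
Qed.

Lemma act_same i x y u v g : open_edge i x -> open_edge i y ->
  act x u v g = act y u v g.
Proof.
move=> [ix nx] [iy ny]; rewrite /act; case: ifP => // _.
rewrite (@eq_pick _ _ (fun j => `[< open_edge j y >])) // => j.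
by apply/asboolP/asboolP => -[jz nz]; [rewrite -(edge_uniq ix jz nx)|
  rewrite -(edge_uniq iy jz ny)].
Qed.

Lemma push_cons d g : reduced (d :: g) -> push d g = d :: g.
Proof.
by case: g => // e g; rewrite reduced_cons /push => /andP[/negPf ->].
Qed.

Variables (p : seq (@oriented_edge R G)) (d0 : @oriented_edge R G).
Hypothesis p_reduced : reduced p.
Local Notation m := (size p).
Local Notation pre k := (rev (take k p)).

Lemma rev_take_S k : (k < m)%N -> pre k.+1 = (nth d0 p k) :: pre k.
Proof. by move=> km; rewrite (take_nth d0 km) rev_rcons. Qed.

Lemma reduced_pre k : reduced (pre k).
Proof. by rewrite reduced_rev; exact: take_sorted. Qed.

Lemma push_pre k : (k < m)%N -> push (nth d0 p k) (pre k) = pre k.+1.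
Proof.
by move=> km; rewrite push_cons -?rev_take_S //; exact: reduced_pre.
Qed.

Section LiftLinear.
Variable c : R -> G.
Hypothesis m_gt0 : (0 < m)%N.
Hypothesis c_linear : forall k t, (k < m)%N -> 0 <= t <= 1 ->
  c ((k%:R + t) / m%:R) = traverse (nth d0 p k) t.

Lemma linear_link k : (k.+1 < m)%N ->
  traverse (nth d0 p k) 1 = traverse (nth d0 p k.+1) 0.
Proof.
move=> km; rewrite -c_linear ?lexx ?ler01 // ?(ltnW km) //.
by rewrite -c_linear ?lexx ?ler01 // natr1 addr0.
Qed.

Variables (n : nat) (v : nat -> G).
Hypothesis n_gt0 : (0 < n)%N.
Hypothesis v_vertex : forall b, V (v b).
Local Notation N := (m * n)%N.
Hypothesis v_star : forall b t, (b < N)%N ->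
  b%:R / N%:R <= t <= b.+1%:R / N%:R -> star (v b) (c t).

Let tau b k t : (b <= N)%N -> (k < m)%N -> b%:R = k%:R * n%:R + t * n%:R :> R ->
  b%:R / N%:R = (k%:R + t) / m%:R.
Proof.
move=> bN km E; rewrite E natrM -mulrDl -mulf_div divff ?mulr1 //.
by rewrite pnatr_eq0 -lt0n.
Qed.

Let x b := c (b%:R / N%:R).

Let v_start k : (k < m)%N -> star (v (k * n)) (traverse (nth d0 p k) 0).
Proof.
move=> km; have bN : (k * n < N)%N by rewrite ltn_pmul2r.
have -> : traverse (nth d0 p k) 0 = x (k * n).
  rewrite /x (@tau _ k 0) ?c_linear ?lexx ?ler01 ?(ltnW bN) //.
  by rewrite mul0r addr0 natrM.
apply: v_star => //; rewrite lexx ler_pM2r ?ler_nat ?leqnSn //.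
by rewrite invr_gt0 ltr0n muln_gt0 m_gt0.
Qed.

Let v_end k : (k < m)%N -> star (v (k * n + n.-1)) (traverse (nth d0 p k) 1).
Proof.
move=> km; have bN : (k * n + n.-1 < N)%N.
  by rewrite (@leq_trans (k.+1 * n)) ?leq_pmul2r // mulSn; lia.
have E : (k * n + n.-1).+1 = (k.+1 * n)%N by rewrite mulSn; lia.
have -> : traverse (nth d0 p k) 1 = x (k * n + n.-1).+1.
  rewrite /x (@tau _ k 1) ?c_linear ?lexx ?ler01 //.
  by rewrite E natrM mulrSr mulrDl.
apply: v_star => //; rewrite lexx ler_pM2r ?ler_nat ?leqnSn //.
by rewrite invr_gt0 ltr0n muln_gt0 m_gt0.
Qed.

Let v_inside k (j : nat) : (k < m)%N -> (j < n)%N ->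
  star (v (k * n + j)) (traverse (nth d0 p k) (1 / 2)).
Proof.
move=> km jn; have bN : (k * n + j < N)%N.
  by rewrite (@leq_trans (k.+1 * n)) ?leq_pmul2r // mulSn; lia.
have n0 : 0 < n%:R :> R by rewrite ltr0n.
have m0 : 0 < m%:R :> R by rewrite ltr0n.
have j0 : 0 <= j%:R :> R by rewrite ler0n.
have jn1 : j%:R + 1 <= n%:R :> R by rewrite natr1 ler_nat.
(* The middle of the [j]-th of the [n] segments of the edge is interior to it, and [star_same] then
   transfers membership in the star to [1 / 2]. *)
pose q : R := (j%:R + 1/2) / n%:R.
have t01 : 0 < q < 1.
  by apply/andP; split; [rewrite divr_gt0 //|rewrite ltr_pdivrMr //]; lra.
apply: (@star_same (nth d0 p k).1 _ (traverse (nth d0 p k) q)) => //.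
- exact: open_edge_traverse.
- by apply: open_edge_traverse; lra.
rewrite -c_linear //; last by case/andP: t01 => /ltW -> /ltW ->.
apply: v_star => //.
have -> : (k%:R + q) / m%:R = ((k * n + j)%:R + 1/2) / N%:R :> R.
  by rewrite /q natrD !natrM; field; rewrite ?gt_eqF.
rewrite !ler_pM2r ?invr_gt0 ?ltr0n ?muln_gt0 ?m_gt0 //.
rewrite -[(k * n + j).+1%:R]natr1.
by apply/andP; split; lra.
Qed.

(** The subdivision points strictly inside the [k]-th edge all act as its midpoint does, so the
    changes of star telescope by [act_comp]. *)
Let lift_linear_block k (j : nat) : (k < m)%N -> (j < n)%N ->
  lift v x (k * n) = pre k -> v (k * n) = traverse (nth d0 p k) 0 ->
  lift v x (k * n + j) =
    act (traverse (nth d0 p k) (1/2)) (traverse (nth d0 p k) 0)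
      (v (k * n + j)) (pre k).
Proof.
move=> km + lk vk; elim: j => [|j IH] jn; first by rewrite addn0 lk vk act_refl.
have jn' : (j < n)%N by exact: ltnW.
have n0 : 0 < n%:R :> R by rewrite ltr0n.
pose q : R := j.+1%:R / n%:R.
have t01 : 0 < q < 1.
  by rewrite divr_gt0 ?ltr0n //= ltr_pdivrMr // mul1r ltr_nat.
have xE : x (k * n + j).+1 = traverse (nth d0 p k) q.
  rewrite /x (@tau _ k q) ?c_linear //.
  - by case/andP: t01 => /ltW -> /ltW ->.
  - by rewrite (@leq_trans (k.+1 * n)) ?leq_pmul2r // mulSn; lia.
  by rewrite /q -addnS natrD natrM mulfVK // gt_eqF.
rewrite addnS /= IH // xE.
have half : open_edge (nth d0 p k).1 (traverse (nth d0 p k) (1/2)).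
  by apply: open_edge_traverse; lra.
rewrite (@act_same (nth d0 p k).1 _ (traverse (nth d0 p k) (1/2))) //;
  last exact: open_edge_traverse.
rewrite act_comp -?addnS //.
- by have [] := traverse_vertex (nth d0 p k).
- by have [] := star_traverse half.
- exact: v_inside.
- exact: v_inside.
- exact: reduced_pre.
Qed.

Let lift_linear_start k : (k < m)%N ->
  lift v x (k * n) = pre k /\ v (k * n) = traverse (nth d0 p k) 0.
Proof.
elim: k => [|k IH] km.
  rewrite mul0n take0; split => //.
  have [V0 _] := traverse_vertex (nth d0 p 0).
  by rewrite [RHS](star_vertex (v_start km) V0) mul0n.
have km' : (k < m)%N by exact: ltnW.
have [V0 _] := traverse_vertex (nth d0 p k.+1).
have vE := star_vertex (v_start km) V0.
split => //; have [lk vk] := IH km'.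
have E : (k.+1 * n = (k * n + n.-1).+1)%N by rewrite mulSn; lia.
have [_ V1] := traverse_vertex (nth d0 p k).
have vE' := star_vertex (v_end km') V1.
(* The point between blocks [k] and [k.+1] is a vertex, which forces the labels on both sides of it
   to be that vertex; the change of star there is trivial, and block [k] has contributed exactly its
   own edge. *)
rewrite E /= -E -vE -vE' linear_link // act_refl.
rewrite lift_linear_block ?prednK // -vE'.
by rewrite act_push ?push_pre //; apply: open_edge_traverse; lra.
Qed.

Lemma lift_linear : lift v x N.-1 = rev p.
Proof.
have km : (m.-1 < m)%N by rewrite prednK.
have [lk vk] := lift_linear_start km.
have E : (N.-1 = m.-1 * n + n.-1)%N.
  by rewrite -[in LHS](prednK m_gt0) mulSn; lia.
have [_ V1] := traverse_vertex (nth d0 p m.-1).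
rewrite E lift_linear_block ?prednK // -(star_vertex (v_end km) V1).
rewrite act_push ?push_pre ?prednK ?take_size //.
by apply: open_edge_traverse; lra.
Qed.

End LiftLinear.
End LinearPath.

(** * Retraction of the universal cover on an edge *)

Lemma glue_segments (R : realType) (tau : nat -> R) (F : nat -> R -> R) n :
  (forall b, tau b <= tau b.+1) ->
  (forall b, (b <= n)%N -> {within `[tau b, tau b.+1], continuous (F b)}) ->
  (forall b, (b < n)%N -> F b (tau b.+1) = F b.+1 (tau b.+1)) ->
  exists2 h : R -> R, {within `[tau 0, tau n.+1], continuous h} &
    forall b t, (b <= n)%N -> tau b <= t <= tau b.+1 -> h t = F b t.
Proof.
move=> tauS; elim: n => [|n IH] Fc Feq.
  by exists (F 0) => [|b t]; [exact: Fc | rewrite leqn0 => /eqP ->].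
have [||h hc hF] := IH.
- by move=> b bn; apply: Fc; exact: leqW.
- by move=> b bn; apply: Feq; exact: leqW.
have tau_mono a b : (a <= b)%N -> tau a <= tau b.
  by move=> ab; apply: (homo_leq (r := <=%R)) ab => //; exact: le_trans.
have glue : h (tau n.+1) = F n.+1 (tau n.+1).
  by rewrite (hF n) ?Feq // lexx tauS.
exists (fun t => if t <= tau n.+1 then h t else F n.+1 t); last first.
  move=> b t bn /andP[bt tb]; case: ifP => [tn|/negbT].
    have [bn'|nb] := leqP b n; first by rewrite (hF b) ?bt.
    have E : b = n.+1 by apply/eqP; rewrite eqn_leq bn.
    by rewrite E -(_ : tau n.+1 = t) //; apply/eqP; rewrite eq_le tn -E bt.
  rewrite -ltNge => nt; suff -> : b = n.+1 by [].
  apply/eqP; rewrite eqn_leq bn ltnNge; apply/negP => nb.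
  have := lt_le_trans nt (le_trans tb (tau_mono _ _ (nb : (b.+1 <= n.+1)%N))).
  by rewrite ltxx.
have -> : [set` `[tau 0, tau n.+2]] =
    `[tau 0, tau n.+1] `|` `[tau n.+1, tau n.+2].
  apply/seteqP; split => t /=; rewrite !in_itv /=.
    move=> /andP[t0 ->]; have [tn|/ltW tn] := leP t (tau n.+1).
      by left; rewrite t0.
    by right; rewrite tn.
  case=> /andP[t1 t2]; first by rewrite t1 (le_trans t2).
  by rewrite t2 andbT (le_trans _ t1) // tau_mono.
apply: withinU_continuous; [exact: itv_closed | exact: itv_closed | |].
  by apply: eq_within_continuous hc => t; rewrite /= in_itv /= => /andP[_ ->].
apply: eq_within_continuous (Fc n.+1 (leqnn _)) => t.
rewrite /= in_itv /= => /andP[nt _]; case: ifP => // tn.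
by rewrite (_ : t = tau n.+1) ?glue //; apply/eqP; rewrite eq_le tn nt.
Qed.

Section EdgeCoordinate.
Context {R : realType} {G : graph R}.
Implicit Types (i j : 'I_(nb_edges G)) (x y u v w : G).
Implicit Types (d e D : @oriented_edge R G) (g P : seq (@oriented_edge R G)).

Local Notation V := (@vertices R G).

Lemma edge_coord i : exists g : G -> R, {within edge i, continuous g} /\
  forall t, 0 <= t <= 1 -> g (param i t) = t.
Proof.
have [_ _ [g gc gK]] := param_homeo i; exists g; split => // t t01.
Qed.

Definition coord i : G -> R := projT1 (cid (edge_coord i)).

Definition dart_coord d x : R := if d.2 then 1 - coord d.1 x else coord d.1 x.

Lemma dart_coordK d t : 0 <= t <= 1 -> dart_coord d (traverse d t) = t.
Proof.
have [_ cK] := projT2 (cid (edge_coord d.1)).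
move=> t01; rewrite /dart_coord /traverse; case: d.2; rewrite /coord cK //.
  by rewrite opprB addrC subrK.
by lra.
Qed.

Lemma dart_coord_continuous d : {within edge d.1, continuous (dart_coord d)}.
Proof.
have [cc _] := projT2 (cid (edge_coord d.1)).
rewrite /dart_coord; case: d.2; last exact: cc.
by move=> x; apply: cvgB; [exact: cvg_cst | exact: cc].
Qed.

Lemma traverse_dart_coord d x : edge d.1 x ->
  traverse d (dart_coord d x) = x /\ 0 <= dart_coord d x <= 1.
Proof.
rewrite edge_traverse => -[t]; rewrite /= in_itv /= => t01 <-.
by rewrite dart_coordK.
Qed.

(* The universal cover is a tree, which the lift of the edge [D] joining the
   vertices [P] and [D :: P] separates; this is the retraction of the tree on
   that edge, at the point over [x] in the star of the vertex [g]. *)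
Definition retract D P g x : R :=
  if `[< open_edge D.1 x >] && ((g == P) || (g == D :: P)) then dart_coord D x
  else (suffix (D :: P) g)%:R.

Variables (v0 : G) (D : @oriented_edge R G) (P : seq (@oriented_edge R G)).
Hypothesis DP_reduced : reduced (D :: P).
Hypothesis P_chain : chain v0 P (traverse D 0).

Let on_edge g := (g == P) || (g == D :: P).

Let on_edge_push d g : chain v0 g (traverse d 0) -> d.1 = D.1 -> on_edge g ->
  on_edge (push d g).
Proof.
move=> ch dD /orP[/eqP gP|/eqP gP]; subst g; rewrite /on_edge.
  by rewrite (dart_uniq dD (chain_uniq ch P_chain)) push_cons // eqxx orbT.
have -> : d = inv_dart D.
  by apply: dart_uniq => //; rewrite traverse_inv subr0; case: ch.
by rewrite /push inv_dartK !eqxx.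
Qed.

(** The retraction depends on the point of the tree and not on the star used to describe it. A push
    along another edge does not change the side of the lifted edge. A push along [D.1] exchanges the
    ends of the lifted edge, where the value is a coordinate of [x], or happens away from it and
    keeps the side. *)
Lemma retract_act u v g x : V u -> V v -> star u x -> star v x ->
  reduced g -> chain v0 g u -> retract D P (act x u v g) x = retract D P g x.
Proof.
move=> Vu Vv ux vx rg ch.
have [->|/eqP uv] := eqVneq u v; first by rewrite act_refl.
have [d [dx d0 d1]] := act_dart Vu Vv ux vx uv.
move: ch; rewrite -d0 -d1 act_push // => ch.
rewrite /retract -/(on_edge g) -/(on_edge _).
have [dD|dD] := eqVneq d.1 D.1.
  have -> : on_edge (push d g) = on_edge g.
    apply/idP/idP; last exact: on_edge_push.
    rewrite -{2}(push_inv d rg); apply: on_edge_push => //.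
    by rewrite traverse_inv subr0; exact: chain_push.
  case: ifP => // /negbT; rewrite negb_and => nDg; congr (_%:R).
  have {}nDg : ~~ on_edge g.
    by case/orP: nDg => // /asboolP; rewrite -dD.
  have [-> //|[[gP _]|[gP _]]] := suffix_push D P d g.
    by move: nDg; rewrite /on_edge gP eqxx.
  by move: nDg; rewrite /on_edge gP eqxx orbT.
case: asboolP => [[Dx nx]|_] /=.
  by case/eqP: dD; case: dx => dx _; exact: edge_uniq nx.
have [-> //|[[_ E]|[_ E]]] := suffix_push D P d g.
  by move: dD; rewrite E eqxx.
by move: dD; rewrite E eqxx.
Qed.

Lemma retract_vertex g x : V x -> retract D P g x = (suffix (D :: P) g)%:R.
Proof. by move=> Vx; rewrite /retract; case: asboolP => // -[]. Qed.

Lemma retract_inside g x : 0 < retract D P g x < 1 ->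
  [/\ open_edge D.1 x, on_edge g & retract D P g x = dart_coord D x].
Proof.
rewrite /retract -/(on_edge g); case: asboolP => Dx /=.
  by case: ifP => //; case: suffix; rewrite ltxx ?andbF.
by case: suffix; rewrite ltxx ?andbF.
Qed.

(** If [g] is not an end of the lifted edge, the function is constant. Otherwise it is a coordinate
    over the closed edge and a constant off the open edge; the two closed pieces meet only over [v],
    whose coordinate is 0 for [P] and 1 for [D :: P]. *)
Lemma retract_continuous (c : R -> G) (a b : R) v g : continuous c -> V v ->
  (forall t, a <= t <= b -> star v (c t)) -> chain v0 g v ->
  {within `[a, b], continuous (fun t => retract D P g (c t))}.
Proof.
move=> cc Vv cv ch; have [gP|gP] := boolP (on_edge g); last first.
  have -> : (fun t => retract D P g (c t)) = cst (suffix (D :: P) g)%:R.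
    by apply/funext => t; rewrite /retract -/(on_edge g) (negPf gP) andbF.
  by move=> t; exact: cvg_cst.
have vD : edge D.1 v /\ dart_coord D v = (suffix (D :: P) g)%:R.
  case/orP: gP => /eqP E; subst g.
    rewrite (chain_uniq ch P_chain) dart_coordK ?lexx ?ler01 //.
    rewrite (_ : suffix _ _ = false); last first.
      by apply/negP => /size_suffix; rewrite ltnn.
    split => //; rewrite /traverse; apply: mem_edge.
    by case: D.2; rewrite ?subr0 ?lexx ?ler01.
  case: ch => -> _; rewrite dart_coordK ?lexx ?ler01 // suffix_refl.
  split => //; rewrite /traverse; apply: mem_edge.
  by case: D.2; rewrite ?subrr ?lexx ?ler01.
have -> : [set` `[a, b]] = (`[a, b] `&` c @^-1` edge D.1) `|`
    (`[a, b] `&` c @^-1` (~` open_edge D.1)).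
  rewrite -setIUr; apply/esym/setIidPl => t _ /=.
  by have [[? ?]|?] := pselect (open_edge D.1 (c t)); [left|right].
have cl (S : set G) : closed S -> closed (`[a, b] `&` c @^-1` S).
  move=> cS; apply: closedI; first exact: itv_closed.
  by apply: preimage_closed => // t _; exact: cc.
apply: withinU_continuous.
- exact/cl/edge_closed.
- exact/cl/closed_open_edgeC.
- have := @continuous_within_comp _ _ _ (`[a, b] `&` c @^-1` edge D.1) _ c _
    cc _ (@dart_coord_continuous D).
  move/(_ (fun t tA => tA.2)); apply: eq_within_continuous => t.
  case=> /=; rewrite in_itv /= => tab Dt.
  rewrite /retract -/(on_edge g) gP andbT; case: asboolP => // nD.
  have Vt : V (c t) by apply: contrapT => nV; apply: nD.
  by rewrite (star_vertex (cv _ tab) Vt); case: vD.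
- have := @cst_continuous (subspace (`[a, b] `&` c @^-1` (~` open_edge D.1))) _
    ((suffix (D :: P) g)%:R : R).
  apply: eq_within_continuous => t.
  case=> /= _ nD.
  by rewrite /retract; case: asboolP => // /nD.
Qed.

End EdgeCoordinate.

(** * Crossings of the edges of a reduced path by a homotopic path *)

Section Crossings.
Context {R : realType} {G : graph R}.

Local Notation V := (@vertices R G).

Lemma chain_rev_take (p : seq (@oriented_edge R G)) (d0 : oriented_edge) k :
  (forall l, (l.+1 < size p)%N ->
    traverse (nth d0 p l) 1 = traverse (nth d0 p l.+1) 0) ->
  (k < size p)%N ->
  chain (traverse (nth d0 p 0) 0) (rev (take k p)) (traverse (nth d0 p k) 0).
Proof.
move=> link; elim: k => [|k IH] km; first by rewrite take0.
rewrite (rev_take_S d0 (ltnW km)) /=; split; first by rewrite link.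
exact/IH/ltnW.
Qed.

(** [h k] stands for the retraction of the lift of [c] on the [k]-th edge of the lift of [p]. The
    second clause reflects that distinct open edges of the tree are disjoint. *)
Definition crosses (p : seq (@oriented_edge R G)) (d0 : oriented_edge)
    (c : R -> G) (h : nat -> R -> R) :=
  (forall k, (k < size p)%N -> [/\ continuous (h k), h k 0 = 0, h k 1 = 1 &
    forall t, 0 <= t <= 1 -> 0 < h k t < 1 ->
      c t = traverse (nth d0 p k) (h k t)]) /\
  forall (k l : nat) t, (k < l < size p)%N -> 0 <= t <= 1 -> 0 < h k t < 1 ->
    ~~ (0 < h l t < 1).

(** By [lift_homotopic] and [lift_linear], the lift of [H (0, _)] ends at [rev p]. The retraction on
    the [k]-th edge thus starts at 0, on the side of the empty word, and ends at 1, as [rev p] has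
    [rev (take k.+1 p)] as a suffix. *)
Lemma crossing_functions (H : R * R -> G) (p : seq (@oriented_edge R G))
    (d0 : oriented_edge) (x0 x1 : G) :
  continuous H -> V x0 -> V x1 ->
  (forall s, 0 <= s <= 1 -> H (s, 0) = x0 /\ H (s, 1) = x1) ->
  reduced p -> (0 < size p)%N ->
  (forall k t, (k < size p)%N -> 0 <= t <= 1 ->
    H (1, (k%:R + t) / (size p)%:R) = traverse (nth d0 p k) t) ->
  exists h, crosses p d0 (fun t => H (0, t)) h.
Proof.
move=> cH Vx0 Vx1 sides rp m0 lin.
have [N0 labels] := grid_labels cH.
(* A multiple of [size p], so that the vertices of [p] are subdivision points, and large enough for
   [grid_labels]. *)
pose n := N0.+1; pose N := (size p * n)%N.
have Ngt0 : (0 < N)%N by rewrite muln_gt0 m0.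
have [||v [Vv Hv]] := labels N _ _ => //.
  by rewrite /N /n (@leq_trans n) ?leq_pmull.
pose tau (b : nat) : R := b%:R / N%:R.
have N0R : 0 < N%:R :> R by rewrite ltr0n.
have tauS b : tau b <= tau b.+1 by rewrite ler_pM2r ?invr_gt0 // ler_nat.
have tau0 : tau 0 = 0 by rewrite /tau mul0r.
have tauN : tau N.-1.+1 = 1 by rewrite /tau prednK // divff // gt_eqF.
have cHs s : continuous (fun t => H (s, t)).
  move=> t; apply: (@continuous_comp _ _ _ (fun t => (s, t)) H); last exact: cH.
  exact: continuous_pairl.
pose c t := H (0, t).
have cc : continuous c by exact: cHs.
have z01 : 0 <= (0 : R) <= 1 by rewrite lexx ler01.
have o01 : 0 <= (1 : R) <= 1 by rewrite lexx ler01.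
have c0 : c 0 = x0 by have [] := sides 0 z01.
have c1 : c 1 = x1 by have [] := sides 0 z01.
have lift_end : lift (v 0) (fun b => c (tau b)) N.-1 = rev p.
  rewrite [LHS](lift_homotopic cH Ngt0 Vv Hv Vx0 Vx1 sides).
  apply: (lift_linear (d0 := d0) rp (c := fun t => H (1, t))) => //.
  move=> b t bN tb; apply: Hv => //; first by rewrite prednK.
  rewrite -/(tau N.-1) -/(tau N.-1.+1) tauN lexx andbT.
  by rewrite -[X in _ <= X]tauN tauS.
pose g b := lift (v 0) (fun b => c (tau b)) b.
have cv b t : (b < N)%N -> tau b <= t <= tau b.+1 -> star (v 0 b) (c t).
  move=> bN tb; apply: Hv => //.
  by rewrite -/(tau 0) -/(tau 1) tau0 lexx -{1}tau0 tauS.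
have v00 : v 0 0 = x0.
  have /star_vertex : star (v 0 0) (c 0).
    by apply: cv => //; rewrite tau0 lexx -{1}tau0 tauS.
  by rewrite c0 => /(_ Vx0).
have link l : (l.+1 < size p)%N ->
    traverse (nth d0 p l) 1 = traverse (nth d0 p l.+1) 0.
  by apply: (linear_link (c := fun t => H (1, t))).
have start : traverse (nth d0 p 0) 0 = x0.
  have [<- _] := sides 1 o01; rewrite -lin // addr0 mul0r //.
pose P k := rev (take k p).
have gch b : (b < N)%N -> chain x0 (g b) (v 0 b).
  move=> bN; rewrite -v00; apply: (@chain_lift _ _ (v 0)) => // k kb.
  have k1 : (k < N)%N by exact: ltn_trans kb bN.
  have k2 : (k.+1 < N)%N by exact: leq_ltn_trans kb bN.
  by split; apply: cv => //; rewrite lexx tauS.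
have Pch k : (k < size p)%N -> chain x0 (P k) (traverse (nth d0 p k) 0).
  by move=> km; rewrite -start; exact: chain_rev_take.
have DP k : (k < size p)%N -> reduced (nth d0 p k :: P k).
  by move=> km; rewrite -rev_take_S //; exact: reduced_pre.
(* The retractions seen from the stars of successive segments agree at the common points by
   [retract_act], hence glue; [clamp] extends the result to the whole line. *)
have key (k : nat) : exists h : R -> R, (k < size p)%N -> continuous h /\
    forall b t, (b < N)%N -> tau b <= t <= tau b.+1 ->
      h t = retract (nth d0 p k) (P k) (g b) (c t).
  have [km|] := boolP (k < size p)%N; last by exists id.
  have [|| h hc hE] := @glue_segments R tau
      (fun b t => retract (nth d0 p k) (P k) (g b) (c t)) N.-1 tauS.
  - move=> b bN; have {}bN : (b < N)%N by lia.
    apply: (@retract_continuous _ _ x0 (nth d0 p k) (P k) _ c (tau b)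
      (tau b.+1) (v 0 b)) => //.
    + exact: Pch.
    + by move=> t tb; exact: cv.
    + exact: gch.
  - move=> b bN; have bN2 : (b < N)%N by lia.
    have bN1 : (b.+1 < N)%N by lia.
    rewrite /g /= (@retract_act _ _ x0) //.
    + exact: DP.
    + exact: Pch.
    + by apply: cv => //; rewrite lexx tauS.
    + by apply: cv => //; rewrite lexx tauS.
    + exact: reduced_lift.
    + exact: gch.
  exists (h \o clamp) => _; split.
    apply: continuous_comp_into hc; first exact: clamp_continuous.
    by move=> t /=; rewrite tau0 tauN in_itv; exact: clamp01.
  move=> b t bN tb; rewrite /= clamp_id; first by apply: hE => //; lia.
  have : tau b.+1 <= 1 by rewrite ler_pdivrMr // mul1r ler_nat.
  have : 0 <= tau b by rewrite divr_ge0 ?ler0n.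
  by case/andP: tb; lra.
have [h hP] := choice key.
have seg t : 0 <= t <= 1 -> exists2 b, (b < N)%N & tau b <= t <= tau b.+1.
  move=> /andP[t0]; rewrite le_eqVlt => /orP[/eqP ->|t1].
    exists N.-1; first by rewrite prednK.
    by rewrite tauN lexx andbT -{1}tauN tauS.
  have tN0 : 0 <= t * N%:R by rewrite mulr_ge0 // ltW.
  have /andP[b1 b2] := truncn_itv tN0.
  exists (Num.truncn (t * N%:R)).
    rewrite -(ltr_nat R); apply: le_lt_trans b1 _.
    by rewrite gtr_pMl.
  by rewrite /tau ler_pdivrMr // ler_pdivlMr // b1 ltW.
exists h; split => [k km|k l t /andP[kl lm] t01 hk].
  have [hc hE] := hP k km.
  split => //.
  - rewrite (hE 0) //; last by rewrite tau0 lexx -{1}tau0 tauS.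
    by rewrite c0 retract_vertex //= suffixs0.
  - rewrite (hE N.-1); first last.
    + by rewrite tauN lexx andbT -[X in _ <= X]tauN tauS.
    + by rewrite prednK.
    rewrite c1 retract_vertex // /g lift_end -rev_take_S // suffix_rev.
    by rewrite prefix_take.
  move=> t t01; have [b bN tb] := seg t t01; rewrite (hE b) //.
  case/retract_inside => [[De _] _ ->].
  by have [-> _] := traverse_dart_coord De.
apply/negP => hl; have km : (k < size p)%N by exact: ltn_trans kl lm.
have [b bN tb] := seg t t01.
move: hk; rewrite ((hP k km).2 b t bN tb) => /retract_inside[[Dk nk] gk _].
move: hl; rewrite ((hP l lm).2 b t bN tb) => /retract_inside[[Dl _] gl _].
have size_g q : (q < size p)%N -> (g b == P q) || (g b == nth d0 p q :: P q) ->
    size (g b) = q \/ size (g b) = q.+1.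
  by move=> qm /orP[]/eqP ->; [left|right];
    rewrite /= size_rev size_takel // ltnW.
(* Word lengths show that two edges of the lifted [p] with the common end [g b] are consecutive. As
   [c t] is inside both, they project to the same edge, so the second is the inverse of the first,
   against reducedness. *)
have lE : l = k.+1.
  by case: (size_g k km gk); case: (size_g l lm gl) => -> E; move: E kl;
    clear; lia.
subst l; have := DP k.+1 lm; rewrite /P (rev_take_S d0 km) reduced_cons.
have -> : nth d0 p k.+1 = inv_dart (nth d0 p k).
  apply: dart_uniq; first exact: edge_uniq Dl Dk nk.
  by rewrite traverse_inv subr0 link.
by rewrite inv_dartK eqxx.
Qed.

End Crossings.

(** * Linearizations and their Markov matrices *)

Section Linearization.
Context {R : realType} {G : graph R}.
Implicit Types (i j l : 'I_(nb_edges G)) (f L : G -> G).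
Implicit Types (p : seq (@oriented_edge R G)).

Local Notation V := (@vertices R G).

Lemma edge_crossings f L j d0 : vertex_map f -> linearization f L ->
  exists p, [/\ (0 < size p)%N,
    forall k t, (k < size p)%N -> 0 <= t <= 1 ->
      L (param j ((k%:R + t) / (size p)%:R)) = traverse (nth d0 p k) t &
    exists h, crosses p d0 (f \o param j) h].
Proof.
move=> [cf [fV finj _]].
move=> [_ /(_ j)[p [path_p red_p lin_p [H [cH Hends Hsides]]]]].
have m0 : (0 < size p)%N.
  rewrite lt0n size_eq0; apply/eqP => p0; move: path_p; rewrite p0 /=.
  move/finj; rewrite !inE => /(_ (param0_vertex j) (param1_vertex j)).
  exact: param01.
have lin k t : (k < size p)%N -> 0 <= t <= 1 ->
    L (param j ((k%:R + t) / (size p)%:R)) = traverse (nth d0 p k) t.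
  move=> km t01; have /= -> := lin_p (Ordinal km) t t01.
  by rewrite (tnth_nth d0).
exists p; split => //.
(* The homotopy is continuous on the unit square only; clamping extends it to the plane. *)
pose clamp2 (z : R * R) : R * R := (clamp z.1, clamp z.2).
have cH2 : continuous (H \o clamp2).
  apply: continuous_comp_into cH => [z|z]; last first.
    by split; rewrite /= in_itv /=; exact: clamp01.
  apply: (@cvg_pair _ R R (nbhs z) (nbhs (clamp z.1)) (nbhs (clamp z.2)) _ _ _
    (fun z => clamp z.1) (fun z => clamp z.2)).
    by apply: (@continuous_comp _ _ _ fst (@clamp R) z);
      [exact: cvg_fst | exact: clamp_continuous].
  by apply: (@continuous_comp _ _ _ snd (@clamp R) z);
    [exact: cvg_snd | exact: clamp_continuous].
have H0 s : (H \o clamp2) (s, 0) = H (clamp s, 0).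
  by rewrite /= /clamp2 /= (@clamp_id _ 0) ?lexx ?ler01.
have H1 s : (H \o clamp2) (s, 1) = H (clamp s, 1).
  by rewrite /= /clamp2 /= (@clamp_id _ 1) ?lexx ?ler01.
have [||s _|k t km t01|h [hP hd]] := crossing_functions (d0 := d0)
  (x0 := f (param j 0)) (x1 := f (param j 1)) cH2 _ _ _ red_p m0.
- exact/fV/param0_vertex.
- exact/fV/param1_vertex.
- by rewrite H0 H1; apply: Hsides; exact: clamp01.
- have u01 : 0 <= (k%:R + t) / (size p)%:R <= 1.
    have p0 : 0 < (size p)%:R :> R by rewrite ltr0n.
    rewrite divr_ge0 ?addr_ge0 ?ler0n //=; last by case/andP: t01.
    rewrite ler_pdivrMr // mul1r (@le_trans _ _ (k.+1%:R)) ?ler_nat //.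
    by rewrite -natr1; lra.
  rewrite /= /clamp2 /= (clamp_id u01) (@clamp_id _ 1) ?lexx ?ler01 //.
  by have [_ ->] := Hends _ u01; exact: lin.
exists h; split => // k km; have [hc h0 h1 hE] := hP k km; split => // t t01 ht.
rewrite -(hE t t01 ht).
rewrite /= /clamp2 /= (clamp_id t01) (@clamp_id _ 0) ?lexx ?ler01 //.
by have [-> _] := Hends _ t01.
Qed.

Section MarkovCount.
Variables (L : G -> G) (j : 'I_(nb_edges G)) (p : seq (@oriented_edge R G)).
Variable d0 : @oriented_edge R G.
Local Notation m := (size p).
Hypothesis m_gt0 : (0 < m)%N.
Hypothesis lin : forall k t, (k < m)%N -> 0 <= t <= 1 ->
  L (param j ((k%:R + t) / m%:R)) = traverse (nth d0 p k) t.

Let m0 : 0 < m%:R :> R. Proof. by rewrite ltr0n. Qed.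

Let grid_decomp (t : R) : 0 <= t <= 1 ->
  exists k u, [/\ (k < m)%N, 0 <= u <= 1 & t = (k%:R + u) / m%:R].
Proof.
move=> /andP[t0]; rewrite le_eqVlt => /orP[/eqP ->|t1].
  exists m.-1, 1; rewrite prednK // lexx ler01; split => //.
  by rewrite natr1 prednK // divff // gt_eqF.
have tm0 : 0 <= t * m%:R by rewrite mulr_ge0 // ltW.
have /andP[b1 b2] := truncn_itv tm0.
exists (Num.truncn (t * m%:R)), (t * m%:R - (Num.truncn (t * m%:R))%:R).
split.
- by rewrite -(ltr_nat R); apply: le_lt_trans b1 _; rewrite gtr_pMl.
- by move: b1 b2; rewrite -natr1; lra.
by rewrite addrC subrK mulfK // gt_eqF.
Qed.

Let vertex_grid (t : R) : 0 <= t <= 1 -> V (L (param j t)) ->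
  exists2 k : nat, (k <= m)%N & t = k%:R / m%:R.
Proof.
move=> t01 Vt; have [k [u [km u01 tE]]] := grid_decomp t01.
move: Vt; rewrite tE lin // => Vu.
have [u0|u0] := eqVneq u 0; first by exists k; rewrite ?(ltnW km) // u0 addr0.
have [u1|u1] := eqVneq u 1; first by exists k.+1; rewrite // u1 natr1.
have : 0 < u < 1 by rewrite !lt_neqAle eq_sym u0 u1; case/andP: u01 => -> ->.
by case/(open_edge_traverse (nth d0 p k)).
Qed.

(** The points of [[a, b]] sent to the two ends of edge [i] are distinct multiples of [1 / m], since
    [L] meets vertices only there. So [[a, b]] contains a whole cell of the grid, which is already
    mapped onto the edge, and injectivity leaves room for nothing more. *)
Lemma homeo_subinterval i (J : set G) : closed_subinterval j J ->
  maps_homeomorphically L J (edge i) -> exists k : 'I_m,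
    (nth d0 p k).1 = i /\ J = param j @` `[k%:R / m%:R, k.+1%:R / m%:R].
Proof.
move=> [a [b [a0 ab b1 ->]]] [_ [im inj sur] _].
have in01 t : a <= t <= b -> 0 <= t <= 1 by lra.
have pre s : 0 <= s <= 1 -> exists2 t, a <= t <= b & L (param j t) = param i s.
  move=> s01; have [_ [t tab <-] E] := sur _ (mem_edge i s01).
  by exists t => //; rewrite /= in_itv in tab.
have injt t u : a <= t <= b -> a <= u <= b ->
    L (param j t) = L (param j u) -> t = u.
  move=> tab uab E; apply: (@param_inj _ _ j); [exact: in01|exact: in01|].
  by apply: inj => //; rewrite inE; [exists t|exists u]; rewrite //= in_itv.
have [|ta taab taE] := pre 0; first by rewrite lexx ler01.
have [|tb tbab tbE] := pre 1; first by rewrite lexx ler01.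
have [|ka kam kaE] := vertex_grid (in01 _ taab).
  by rewrite taE; exact: param0_vertex.
have [|kb kbm kbE] := vertex_grid (in01 _ tbab).
  by rewrite tbE; exact: param1_vertex.
have kab : ka <> kb.
  by move=> E; apply: (@param01 _ _ i); rewrite -taE -tbE kaE kbE E.
have [k [km ak kb']] : exists k, [/\ (k < m)%N, a <= k%:R / m%:R &
    k.+1%:R / m%:R <= b].
  have : (ka < kb \/ kb < ka)%N by move: kab; clear; lia.
  case=> k_lt; [exists ka|exists kb]; split; rewrite -?kaE -?kbE.
  - exact: leq_trans k_lt kbm.
  - by case/andP: taab.
  - case/andP: tbab => _; apply: le_trans; rewrite kbE.
    by rewrite ler_pM2r ?invr_gt0 // ler_nat.
  - exact: leq_trans k_lt kam.
  - by case/andP: tbab.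
  - case/andP: taab => _; apply: le_trans; rewrite kaE.
    by rewrite ler_pM2r ?invr_gt0 // ler_nat.
have sub (u : R) : 0 <= u <= 1 ->
    k%:R / m%:R <= (k%:R + u) / m%:R <= k.+1%:R / m%:R.
  by move=> u01; rewrite -natr1 !ler_pM2r ?invr_gt0 //; lra.
have subab (u : R) : 0 <= u <= 1 -> a <= (k%:R + u) / m%:R <= b.
  by move/sub => /andP[u1 u2]; rewrite (le_trans ak u1) (le_trans u2 kb').
have ki : (nth d0 p k).1 = i.
  have h01 : 0 < (1 / 2 : R) < 1 by lra.
  have h01' : 0 <= (1 / 2 : R) <= 1 by lra.
  have [hk nV] := open_edge_traverse (nth d0 p k) h01.
  apply: (edge_uniq hk _ nV); rewrite -lin //; apply: im.
  by exists ((k%:R + 1 / 2) / m%:R) => //; rewrite /= in_itv /= subab.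
exists (Ordinal km); split => //=; congr (_ @` _); apply/seteqP.
split => t; rewrite /= !in_itv /=; last first.
  by case/andP => t1 t2; rewrite (le_trans ak t1) (le_trans t2 kb').
move=> tab.
have : edge i (L (param j t)) by apply: im; exists t; rewrite //= in_itv.
rewrite -ki edge_traverse => -[u]; rewrite /= in_itv /= => u01.
rewrite -lin // => E; rewrite -(injt _ _ (subab _ u01) tab E); exact: sub.
Qed.

Lemma markov_count i :
  (markov_matrix L i j <= #|[pred k : 'I_m | (nth d0 p k).1 == i]|)%N.
Proof.
rewrite mxE; set S := [set J | _].
pose F (k : 'I_m) := param j @` `[k%:R / m%:R, k.+1%:R / m%:R] : set G.
have SF J : S J -> exists2 k, (nth d0 p (k : 'I_m)).1 == i & J = F k.
  by case=> [sJ hJ]; have [k [/eqP ki ->]] := homeo_subinterval sJ hJ; exists k.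
have finS : finite_set S.
  apply: (@sub_finite_set _ _ [set F k | k in setT]); last first.
    by apply: finite_image; exact: finite_finset.
  by move=> J /SF[k _ ->]; exists k.
set K := [pred k | _].
have -> : #|K| = size [seq F k | k <- enum K] by rewrite size_map -cardE.
apply: uniq_leq_size; first exact: fset_uniq.
move=> J; rewrite in_fset_set // inE => /SF[k ki ->].
by apply: map_f; rewrite mem_enum.
Qed.

End MarkovCount.
End Linearization.

(** * Families of subintervals covering an edge *)

Section CoveringFamilies.
Context {R : realType} {G : graph R}.
Implicit Types (i j : 'I_(nb_edges G)) (f g L : G -> G).

(** The subintervals lie on edge [j] and each covers edge [i]; letting the two edges differ is what
    allows composition of maps in an induction, while [i = j] gives a horseshoe. *)
Definition covering_family g i j n := exists a b : nat -> R,
  (forall u, (u < n)%N -> [/\ 0 <= a u, a u < b u, b u <= 1 &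
    edge i `<=` g @` (param j @` `[a u, b u])]) /\
  forall u w, (u < n)%N -> (w < n)%N -> u != w ->
    forall t, a u < t < b u -> ~~ (a w < t < b w).

Lemma covering_family_fin g i j n (T : finType) (a b : T -> R) :
  (n <= #|T|)%N ->
  (forall u, [/\ 0 <= a u, a u < b u, b u <= 1 &
    edge i `<=` g @` (param j @` `[a u, b u])]) ->
  (forall u w, u != w -> forall t, a u < t < b u -> ~~ (a w < t < b w)) ->
  covering_family g i j n.
Proof.
case: n => [|n] nT cov dis; first by exists (fun=> 0), (fun=> 0).
have x0 : T.
  by apply: (@enum_val _ T); exact: (Ordinal (leq_trans (ltn0Sn n) nT)).
exists (fun u => a (nth x0 (enum T) u)), (fun u => b (nth x0 (enum T) u)).
split=> [u _|u w un wn uw]; first exact: cov.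
by apply: dis; rewrite nth_uniq ?enum_uniq -?cardE ?(leq_trans _ nT).
Qed.

Lemma covering_family_horseshoe g i n :
  covering_family g i i n -> horseshoe i n g.
Proof.
move=> [a [b [cov dis]]]; exists (fun u => a u), (fun u => b u); split.
- by move=> u; have [] := cov u (ltn_ord u).
- apply/trivIsetP => u w _ _ uw; apply/seteqP; split => t //= -[].
  rewrite !in_itv /= => tu.
  by rewrite (negPf (dis u w (ltn_ord u) (ltn_ord w) uw t tu)).
move=> x [u _ [t /= tu <-]] w _; have [_ _ _] := cov w (ltn_ord w); apply.
have [au ab bu _] := cov u (ltn_ord u).
move: tu; rewrite in_itv /= => /andP[ta tb].
by apply: mem_edge; rewrite (le_trans au ta) (le_trans tb bu).
Qed.

Variables (f L : G -> G).
Hypotheses (f_vertex : vertex_map f) (L_lin : linearization f L).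

Let f_continuous : continuous f. Proof. by case: f_vertex. Qed.

(** [lower] and [upper] are the ends, in increasing order, of the image of [[a, b]] under
    [orient d]. *)
Definition lower (d : @oriented_edge R G) (a b : R) := if d.2 then 1 - b else a.
Definition upper (d : @oriented_edge R G) (a b : R) := if d.2 then 1 - a else b.

(* Closedness of the image supplies the two ends, where [crosses] says
   nothing. *)
Lemma crossing_covers j (h : R -> R) (d : @oriented_edge R G) (a b a' b' : R) :
  continuous h -> 0 <= a -> a < b -> b <= 1 -> 0 <= a' -> a' < b' -> b' <= 1 ->
  h a' = lower d a b -> h b' = upper d a b ->
  (forall t, 0 <= t <= 1 -> 0 < h t < 1 -> f (param j t) = traverse d (h t)) ->
  param d.1 @` `[a, b] `<=` f @` (param j @` `[a', b']).
Proof.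
move=> hc a0 ab b1 a0' ab' b1' ha hb hE.
set K := f @` _.
have cK : closed K.
  apply: compact_closed; first exact: graph_hausdorff.
  apply: continuous_compact; first exact: continuous_subspaceT.
  apply: continuous_compact; last exact: segment_compact.
  have [pc _ _] := param_homeo j; apply: continuous_subspaceW pc => t /=.
  by rewrite !in_itv /=; lra.
move=> _ [t /= tab <-]; rewrite in_itv /= in tab.
have t01 : 0 <= t <= 1 by lra.
(* Composing with [clamp] makes the parametrization continuous on the line, so that the preimage of
   [K] is closed there. *)
rewrite -(clamp_id t01).
apply: (@closed_itvoo_sub R ((param d.1 \o clamp) @^-1` K) a b) => //.
  by apply: preimage_closed => // z _; exact: param_clamp_continuous.
clear t tab t01 => t tab /=.
have t01 : 0 < t < 1 by lra.
have o01 : 0 < orient d t < 1 by rewrite /orient; case: d.2; lra.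
rewrite clamp_id -?traverse_orient; last by lra.
have [|u uab uE] := @intermediate_value R h a' b' (orient d t) hc (ltW ab').
  by rewrite ha hb /lower /upper /orient; case: d.2; lra.
rewrite -uE -hE ?uE //; last by lra.
by exists (param j u) => //; exists u; rewrite //= in_itv.
Qed.

(** Induction on [k], applying [f] first. Each occurrence of an edge [l] in the path [p] of [j] lets
    the [(M ^+ k) i l] intervals of [l] be pulled back to [j]. By [markov_count] there are at least
    [M l j] occurrences, and summing over [l] gives the entry of [M ^+ k.+1]. *)
Lemma iterate_covering_family k i j :
  covering_family (iter k f) i j ((markov_matrix L ^+ k) i j).
Proof.
elim: k j => [|k IH] j.
  rewrite expr0 mxE; have [<-|_] := eqVneq i j;
    last by exists (fun=> 0), (fun=> 0).
  exists (fun=> 0), (fun=> 1); split=> [u _|[|u] [|w]//].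
  by split; rewrite ?lexx ?ltr01 // => x ix; exists x.
pose d0 : @oriented_edge R G := (j, false).
have [p [m0 lin [h [hP hd]]]] := edge_crossings j d0 f_vertex L_lin.
set M := markov_matrix L in IH *.
pose D (x : 'I_(size p)) := nth d0 p x.
have ab_ex l : exists c : (nat -> R) * (nat -> R),
  (forall u, (u < (M ^+ k) i l)%N -> [/\ 0 <= c.1 u, c.1 u < c.2 u, c.2 u <= 1 &
    edge i `<=` iter k f @` (param l @` `[c.1 u, c.2 u])]) /\
  forall u w, (u < (M ^+ k) i l)%N -> (w < (M ^+ k) i l)%N -> u != w ->
    forall t, c.1 u < t < c.2 u -> ~~ (c.1 w < t < c.2 w).
  by have [a [b ?]] := IH l; exists (a, b).
have [ab abP] := choice ab_ex.
pose T := {x : 'I_(size p) & 'I_((M ^+ k) i (D x).1)}.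
pose A (y : T) : R := (ab (D (tag y)).1).1 (tagged y).
pose B (y : T) : R := (ab (D (tag y)).1).2 (tagged y).
have ABP (y : T) : [/\ 0 <= A y, A y < B y, B y <= 1 &
    edge i `<=` iter k f @` (param (D (tag y)).1 @` `[A y, B y])].
  by have [+ _] := abP (D (tag y)).1; apply; exact: ltn_ord.
have lu (y : T) : [/\ 0 <= lower (D (tag y)) (A y) (B y),
    lower (D (tag y)) (A y) (B y) < upper (D (tag y)) (A y) (B y) &
    upper (D (tag y)) (A y) (B y) <= 1].
  have [? ? ? _] := ABP y.
  by rewrite /lower /upper; case: (D (tag y)).2; split; lra.
(* The coordinate goes from 0 to 1, hence crosses the interval of [y]. Keeping it strictly between
   the two levels is what makes pullbacks of disjoint intervals disjoint. *)
have c_ex (y : T) : exists c : R * R, [/\ 0 <= c.1, c.1 < c.2, c.2 <= 1,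
    h (tag y) c.1 = lower (D (tag y)) (A y) (B y) /\
    h (tag y) c.2 = upper (D (tag y)) (A y) (B y) &
    forall t, c.1 < t < c.2 ->
      lower (D (tag y)) (A y) (B y) < h (tag y) t
        < upper (D (tag y)) (A y) (B y)].
  have [hc h0 h1 _] := hP (tag y) (ltn_ord _); have [l0 l1 l2] := lu y.
  rewrite -[X in X <= _]h0 in l0; rewrite -[X in _ <= X]h1 in l2.
  have [a [b abH]] := crossing_interval hc ler01 l0 l1 l2.
  by exists (a, b).
have [c cP] := choice c_ex.
apply: (@covering_family_fin _ _ _ _ T (fun y => (c y).1) (fun y => (c y).2)).
- rewrite exprSr mxE card_tagged sumnE big_map big_enum /=.
  rewrite (partition_big (fun x => (D x).1) xpredT) //=.
  apply: leq_sum => l _.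
  rewrite (eq_bigr (fun=> (M ^+ k) i l)); last first.
    by move=> x /eqP <-; rewrite card_ord.
  rewrite sum_nat_const mulnC leq_mul //; exact: markov_count.
- move=> y; have [c0 c12 c1 [hl hu] _] := cP y.
  have [A0 AB B1 cov] := ABP y; have [hc _ _ hE] := hP (tag y) (ltn_ord _).
  split => // x /cov[z zl <-].
  have [z' z'j <-] := crossing_covers hc A0 AB B1 c0 c12 c1 hl hu hE zl.
  by exists z' => //; rewrite iterSr.
(* At a common time [t] both coordinates lie strictly between 0 and 1, so [crosses] forces the same
   position in [p]; then one point would lie in two disjoint intervals of the same edge. *)
- move=> y z yz t ty; apply/negP => tz.
  have [c0 _ c1 _ hy] := cP y; have [_ _ _ _ hz] := cP z.
  have [ly _ uy] := lu y; have [lz _ uz] := lu z.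
  have t01 : 0 <= t <= 1 by lra.
  have hy1 : 0 < h (tag y) t < 1 by have := hy t ty; lra.
  have hz1 : 0 < h (tag z) t < 1 by have := hz t tz; lra.
  case: (ltngtP (tag y) (tag z)) => tag_yz.
  + have /andP := conj tag_yz (ltn_ord (tag z)).
    by move/hd => /(_ t t01 hy1); rewrite hz1.
  + have /andP := conj tag_yz (ltn_ord (tag y)).
    by move/hd => /(_ t t01 hz1); rewrite hy1.
  have {}tag_yz := val_inj tag_yz.
  clear c0 c1; case: y z => x u [x' w] in
    yz ty tz hy hz ly uy lz uz hy1 hz1 tag_yz *.
  rewrite /= in tag_yz; subst x'.
  have uw : val u != val w by apply: contra_neq yz => /val_inj ->.
  have [_ dis] := abP (D x).1.
  have := dis _ _ (ltn_ord u) (ltn_ord w) uw (orient (D x) (h x t)).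
  have := hy t ty; have := hz t tz; rewrite /lower /upper /A /B /orient /=.
  move=> hz' hy' E; have := E _; case: (D x).2 hz' hy' => hz' hy'.
    by move=> /(_ ltac:(lra)) /negP; apply; lra.
  by move=> /(_ ltac:(lra)) /negP; apply; lra.
Qed.

End CoveringFamilies.

(** * Growth of the powers of a primitive matrix *)

Section Spectral.
Context {R : realType}.

Lemma bounded_expr_le1 (x C : R) : 0 <= x -> (forall k, x ^+ k <= C) -> x <= 1.
Proof.
move=> x0 xC; rewrite leNgt; apply/negP => x1.
have bern k : 1 + (x - 1) * k%:R <= x ^+ k.
  elim: k => [|k IH]; first by rewrite mulr0 addr0 expr0.
  rewrite exprS -natr1; have k0 : 0 <= k%:R :> R by rewrite ler0n.
  have y0 : 0 <= (x - 1) * (x - 1) * k%:R by rewrite !mulr_ge0 // subr_ge0 ltW.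
  have : x * (1 + (x - 1) * k%:R) <= x * x ^+ k by rewrite ler_wpM2l.
  nra.
have y0 : 0 < x - 1 by rewrite subr_gt0.
have C0 : 0 <= C / (x - 1).
  by rewrite divr_ge0 ?(ltW y0) // (le_trans _ (xC 0)) // expr0 ler01.
have /andP[_ b2] := truncn_itv C0.
have := le_trans (bern (Num.truncn (C / (x - 1))).+1) (xC _).
move: b2; rewrite ltr_pdivrMr //; lra.
Qed.

Lemma normc_ge0 (z : complex R) : 0 <= Normc.normc z.
Proof. by case: z => a b; exact: sqrtr_ge0. Qed.

Lemma normc_sum n (F : 'I_n -> complex R) :
  Normc.normc (\sum_(i < n) F i) <= \sum_(i < n) Normc.normc (F i).
Proof.
elim/big_ind2: _ => [|r1 z1 r2 z2 h1 h2|//]; first by rewrite Normc.normc0.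
have h : Normc.normc (z1 + z2) <= Normc.normc z1 + Normc.normc z2 :=
  le_normcD z1 z2.
exact: le_trans h (lerD h1 h2).
Qed.

Lemma normc_nat n : Normc.normc (n%:R : complex R) = n%:R.
Proof.
elim: n => [|n IH]; first exact: Normc.normc0.
by rewrite -[_%:R]/((1 : complex R) *+ n.+1) normcMn Normc.normc1.
Qed.

Lemma normcX (z : complex R) k : Normc.normc (z ^+ k) = Normc.normc z ^+ k.
Proof.
elim: k => [|k IH]; first by rewrite !expr0 Normc.normc1.
by rewrite !exprS Normc.normcM IH.
Qed.

Local Notation natC n := (n%:R : complex R).

(** For a left eigenvector [v] with eigenvalue [z], the [j]-th entry of [v *m M ^+ k] is
    [z ^+ k * v 0 j], and its modulus is at most a constant times [r ^+ k]. So the powers of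
    [|z| / r] are bounded, which gives [|z| <= r]. *)
Lemma spectral_radius_le n (M : 'M[nat]_n) (C r : R) : 0 < r ->
  (forall k i j, ((M ^+ k) i j)%:R <= C * r ^+ k) ->
  spectral_radius M <= r.
Proof.
move=> r0 MC; rewrite /spectral_radius; set S := [set _ | _ in _].
(* Without eigenvalues the supremum takes its default value 0. *)
have [->|/set0P Sn0] := eqVneq S set0; first by rewrite sup0 ltW.
apply: ge_sup => // _ [z /= /eigenvalueP[v vM v0] <-].
have [j vj] : exists j, v 0 j != 0.
  apply/existsP; apply: contra_neqT v0 => /existsPn nv.
  by apply/rowP => j; rewrite mxE; apply/eqP; have := nv j; rewrite negbK.
have vMk k : v *m map_mx (fun m => natC m) (M ^+ k) = z ^+ k *: v.
  elim: k => [|k IH].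
    rewrite expr0 scale1r; apply/rowP => q.
    rewrite !mxE (bigD1 q) //= !mxE eqxx.
    rewrite mulr1 big1 ?addr0 // => q' /negPf q'q.
    by rewrite !mxE q'q mulr0.
  have -> : map_mx (fun m => natC m) (M ^+ k.+1) =
      map_mx (fun m => natC m) (M ^+ k) *m map_mx (fun m => natC m) M.
    apply/matrixP => a b; rewrite exprSr !mxE natr_sum.
    by apply: eq_bigr => q _; rewrite !mxE natrM.
  by rewrite mulmxA IH -scalemxAl vM scalerA exprSr.
set vn := \sum_(i < n) Normc.normc (v 0 i).
have vj0 : 0 < Normc.normc (v 0 j).
  rewrite lt_neqAle normc_ge0 andbT eq_sym; apply: contra_neq vj.
  exact: Normc.eq0_normc.
suff : Normc.normc z / r <= 1 by rewrite ler_pdivrMr // mul1r.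
apply: (@bounded_expr_le1 _ (vn * C / Normc.normc (v 0 j))).
  by rewrite divr_ge0 ?normc_ge0 // ltW.
move=> k; rewrite ler_pdivlMr // expr_div_n mulrAC ler_pdivrMr ?exprn_gt0 //.
rewrite -normcX -Normc.normcM.
have <- : (v *m map_mx (fun m => natC m) (M ^+ k)) 0 j = z ^+ k * v 0 j.
  by rewrite vMk mxE.
rewrite mxE; apply: le_trans (normc_sum _) _.
rewrite /vn -mulrA mulr_suml; apply: ler_sum => i _.
rewrite Normc.normcM !mxE normc_nat; apply: ler_wpM2l; last exact: MC.
exact: normc_ge0.
Qed.

Lemma mx_entry_le n (A B : 'M[nat]_n) i l j : (A i l * B l j <= (A *m B) i j)%N.
Proof. by rewrite mxE (bigD1 l) //= leq_addr. Qed.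

(** If the diagonal entry at [e] never grew faster than [expR s ^+ k], no entry would, up to a
    constant: since [M ^+ N] is positive, paths from [e] to [i] and from [j] to [e] bound
    [(M ^+ k) i j] by the entry at [e] of the power [N + k + N]. The spectral radius would then be
    at most [expR s]. *)
Lemma primitive_growth n (M : 'M[nat]_n) (s : R) (e : 'I_n) : primitive_mx M ->
  0 < s -> s < ln (spectral_radius M) ->
  exists2 k, (0 < k)%N & expR (k%:R * s) < ((M ^+ k) e e)%:R.
Proof.
move=> [N N0 MN] s0 sM; apply: contrapT => nk.
have small k : ((M ^+ k) e e)%:R <= expR s ^+ k :> R.
  case: k => [|k]; first by rewrite !expr0 mxE eqxx.
  rewrite leNgt; apply/negP => hk; apply: nk; exists k.+1 => //.
  by rewrite expRM_natl.
have : spectral_radius M <= expR s.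
  apply: (@spectral_radius_le _ _ (expR s ^+ (N + N))); first exact: expR_gt0.
  move=> k i j; rewrite -exprD; apply: le_trans (small _); rewrite ler_nat.
  rewrite addnAC exprD exprD.
  apply: leq_trans (mx_entry_le _ _ _ j _).
  apply: leq_trans (leq_mul (mx_entry_le _ _ _ i _) (leqnn _)).
  have := MN N (leqnn N) e i; have := MN N (leqnn N) j e.
  set A := (M ^+ N) e i; set B := (M ^+ N) j e; set D := (M ^+ k) i j.
  move=> B0 A0; change (D <= A * D * B)%N.
  by rewrite mulnAC leq_pmull // muln_gt0 A0.
move=> hs; have : ln (spectral_radius M) <= s.
  (* On nonpositive numbers [ln] has the default value 0, which is below [s]. *)
  have [Mp|Mn] := ltP 0 (spectral_radius M : R).
    by rewrite -ler_expR lnK // posrE.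
  by rewrite ln0 // ltW.
by rewrite leNgt sM.
Qed.
End Spectral.

Theorem theorem9 (R : realType) (G : graph R) (f L : G -> G) :
  (1 < nb_edges G)%N ->
  vertex_map f ->
  linearization f L ->
  primitive_mx (markov_matrix L) ->
  forall s : R, 0 < s -> s < topological_entropy L ->
  forall E : 'I_(nb_edges G),
  exists k n : nat,
    [/\ (0 < k)%N, (0 < n)%N, s < k%:R^-1 * ln (n%:R : R)
      & horseshoe E n (iter k f)].
Proof.
move=> _ f_vertex L_lin M_prim s s_gt0 s_lt E.
(* A diagonal entry is used because a horseshoe needs the subintervals to lie on the edge that they
   cover. *)
have [k k_gt0 hk] := primitive_growth E M_prim s_gt0 s_lt.
set n := (markov_matrix L ^+ k) E E in hk.
have n_gt0 : 0 < n%:R :> R by exact: lt_trans (expR_gt0 _) hk.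
exists k, n; split => //; first by rewrite -(ltr0n R).
  by rewrite mulrC ltr_pdivlMr ?ltr0n // mulrC -ltr_expR lnK ?posrE.
exact/covering_family_horseshoe/iterate_covering_family.
Qed.
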